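(* Let $\Gamma=[m_{i,j}]_{i,j\in I}$ be a Coxeter matrix and consider the left regular representation of $H_q(\Gamma)$ over $\Lambda=\kappa[v^{\pm1}]$, $q=v^2$. For $j\in I$ let $V_j^q$ and $V_j^{-1}$ be the eigenspaces of (left multiplication by) $T_{s_j}$ of eigenvalue $q$ and $-1$. Then $V_j^{-1}$ is the $\Lambda$-span of $\{C_w: w\in W_\Gamma,\ s_jw<w\}$ and $V_j^{q}$ is the $\Lambda$-span of $\{C'_w: w\in W_\Gamma,\ s_jw<w\}$.
   Context: $\kappa$ is a field, $\Lambda=\kappa[v^{\pm1}]$ a Laurent polynomial ring, $q=v^2$. $W_\Gamma$ is the Coxeter group of $\Gamma$ with generators $s_i$ ($i\in I$), length $l$ and Bruhat order $<$. $H_q(\Gamma)$ is the Iwahori–Hecke algebra over $\Lambda$ generated by $T_{s_i}$ ($i\in I$) with the braid relations of $\Gamma$ and $(T_{s_i}-q)(T_{s_i}+1)=0$; it is $\Lambda$-free with standard basis $\{T_w\}_{w\in W_\Gamma}$. The bar involution is the ring automorphism with $\overline{f(v)}=f(v^{-1})$ and $\overline{T_w}=(T_{w^{-1}})^{-1}$. Put $\epsilon_w=(-1)^{l(w)}$, $v_w=v^{l(w)}$, $q_w=q^{l(w)}$. $C_w$ is the Kazhdan–Lusztig basis element: the unique element with $\overline{C_w}=C_w$ and $C_w=\sum_{y\le w}\epsilon_y\epsilon_w v_w q_y^{-1}\overline{P_{y,w}}\,T_y$, where $P_{w,w}=1$ and, for $y<w$, $P_{y,w}$ is a polynomial in $q$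 of degree $\le\frac12(l(w)-l(y)-1)$. Put $\bar T_s=v^{-1}T_s$. $\delta$ is the $\kappa$-algebra automorphism of $H_q(\Gamma)$ of order two with $\delta(\bar T_{s_j})=\bar T_{s_j}$ for all $j\in I$ and $\delta(v)=-v^{-1}$. $C'_w=\delta(C_w)$. *)

(* Defs.v *)
From HB Require Import structures.
From Stdlib Require Import Relation_Operators.
From mathcomp Require Import all_boot all_order all_algebra.
From mathcomp Require Import generic_quotient.
From mathcomp Require Import boolp classical_sets fsbigop.

Set Implicit Arguments.
Unset Strict Implicit.
Unset Printing Implicit Defensive.

Import GRing.Theory.

Local Open Scope quotient_scope.
Local Open Scope classical_set_scope.

(* The value 0 encodes m_{i,j} = infinity, i.e. no relation between i and j. *)
Record coxeter_matrix (I : Type) := CoxeterMatrix {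
  coxeter_entry :> I -> I -> nat;
  coxeter_diag : forall i, coxeter_entry i i = 1%N;
  coxeter_sym : forall i j, coxeter_entry i j = coxeter_entry j i;
  coxeter_offdiag : forall i j, i <> j -> coxeter_entry i j <> 1%N }.

Section CoxeterGroup.

Variables (I : choiceType) (m : coxeter_matrix I).

(* The diagonal entries 1 give s_i^2 = 1, so that words in the generators
   (without formal inverses) suffice; an entry 0 gives a trivial relation. *)
Inductive word_congr : seq I -> seq I -> Prop :=
| WRel i j : word_congr (flatten (nseq (m i j) [:: i; j])) [::]
| WCat u u' w w' :
    word_congr u u' -> word_congr w w' -> word_congr (u ++ w) (u' ++ w')
| WRefl u : word_congr u u
| WSym u w : word_congr u w -> word_congr w u
| WTrans u w x : word_congr u w -> word_congr w x -> word_congr u x.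

Definition word_eqv : rel (seq I) := fun u w => `[< word_congr u w >].

Lemma word_eqv_refl : reflexive word_eqv.
Proof. by move=> u; apply/asboolP; apply: WRefl. Qed.

Lemma word_eqv_sym : symmetric word_eqv.
Proof. by move=> u w; apply/asboolP/asboolP; apply: WSym. Qed.

Lemma word_eqv_trans : transitive word_eqv.
Proof.
by move=> u w x /asboolP uw /asboolP wx; apply/asboolP; apply: WTrans uw wx.
Qed.

Canonical word_equiv :=
  EquivRel word_eqv word_eqv_refl word_eqv_sym word_eqv_trans.

Definition coxeter_group := {eq_quot word_equiv}.

HB.instance Definition _ := Choice.on coxeter_group.

Definition cox_word (u : seq I) : coxeter_group := \pi_coxeter_group u.

Lemma cox_wordP u w : cox_word u = cox_word w <-> word_congr u w.
Proof.
split=> [/eqP|uw]; last by apply/eqP; rewrite eqmodE; apply/asboolP.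
by rewrite /cox_word eqmodE => /asboolP.
Qed.

Lemma cox_word_repr (x : coxeter_group) : cox_word (repr x) = x.
Proof. exact: reprK. Qed.

Lemma word_congr_square i : word_congr [:: i; i] [::].
Proof. by have := WRel i i; rewrite coxeter_diag. Qed.

Lemma word_congr_rev u : word_congr (rev u ++ u) [::].
Proof.
elim: u => [|i u IHu]; first exact: WRefl.
rewrite rev_cons -cats1 -catA -[[:: i] ++ _]/([:: i; i] ++ u).
apply: WTrans IHu; apply: WCat; first exact: WRefl.
by have := WCat (word_congr_square i) (WRefl u).
Qed.

Definition cox_mul (x y : coxeter_group) := cox_word (repr x ++ repr y).
Definition cox_inv (x : coxeter_group) := cox_word (rev (repr x)).

Lemma cox_word_cat u w : cox_mul (cox_word u) (cox_word w) = cox_word (u ++ w).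
Proof. by apply/cox_wordP; apply: WCat; apply/cox_wordP/cox_word_repr. Qed.

Lemma cox_mulA : associative cox_mul.
Proof.
move=> x y z.
rewrite -[x]cox_word_repr -[y]cox_word_repr -[z]cox_word_repr.
by rewrite !cox_word_cat catA.
Qed.

Lemma cox_mul1 : left_id (cox_word [::]) cox_mul.
Proof. by move=> x; rewrite -[x]cox_word_repr cox_word_cat. Qed.

Lemma cox_mulr1 : right_id (cox_word [::]) cox_mul.
Proof. by move=> x; rewrite -[x]cox_word_repr cox_word_cat cats0. Qed.

Lemma cox_mulV : left_inverse (cox_word [::]) cox_inv cox_mul.
Proof.
move=> x; rewrite /cox_inv -{2}[x]cox_word_repr cox_word_cat.
by apply/cox_wordP; apply: word_congr_rev.
Qed.

Lemma cox_mulrV : right_inverse (cox_word [::]) cox_inv cox_mul.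
Proof.
move=> x; rewrite /cox_inv -{1}[x]cox_word_repr cox_word_cat.
by apply/cox_wordP; rewrite -{1}[repr x]revK; apply: word_congr_rev.
Qed.

HB.instance Definition _ := isGroup.Build coxeter_group
  cox_mulA cox_mul1 cox_mulr1 cox_mulV cox_mulrV.

Definition cox_gen (i : I) : coxeter_group := cox_word [:: i].

Lemma cox_word_prod u : cox_word u = (\prod_(i <- u) cox_gen i)%g.
Proof.
elim: u => [|i u IHu]; first by rewrite big_nil.
by rewrite big_cons -IHu -cat1s -cox_word_cat.
Qed.

Definition expr_length (w : coxeter_group) : pred nat :=
  fun n => `[< exists u : seq I, size u = n /\ (\prod_(i <- u) cox_gen i)%g = w >].

Lemma expr_length_ex w : exists n, expr_length w n.
Proof.
exists (size (repr w)); apply/asboolP; exists (repr w).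
by rewrite -cox_word_prod cox_word_repr.
Qed.

Definition cox_length (w : coxeter_group) : nat := ex_minn (expr_length_ex w).

Definition is_reduced_expr (w : coxeter_group) : pred (seq I) :=
  fun u => `[< size u = cox_length w /\ (\prod_(i <- u) cox_gen i)%g = w >].

Lemma reduced_expr_ex w : exists u, is_reduced_expr w u.
Proof.
rewrite /is_reduced_expr /cox_length; case: ex_minnP => n /asboolP[u uP] _.
by exists u; apply/asboolP.
Qed.

Definition reduced_expr (w : coxeter_group) : seq I :=
  xchoose (reduced_expr_ex w).

Definition reflection (t : coxeter_group) : Prop :=
  exists (x : coxeter_group) (i : I), t = (x * cox_gen i * x^-1)%g.

Definition bruhat_step (y w : coxeter_group) : Prop :=
  exists t, [/\ reflection t, w = (y * t)%g & (cox_length y < cox_length w)%N].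

Definition bruhat_le : coxeter_group -> coxeter_group -> Prop :=
  clos_refl_trans coxeter_group bruhat_step.

Definition bruhat_lt (y w : coxeter_group) : Prop := bruhat_le y w /\ y <> w.

End CoxeterGroup.

Local Open Scope ring_scope.

Section IwahoriHecke.

Variables (R : comNzRingType) (q : R).
Variables (I : choiceType) (m : coxeter_matrix I).

(* The R-algebra with given generators and relations is realised as the
   quotient of formal algebra expressions by the least congruence that contains
   the algebra axioms and the defining relations; HScal a stands for a * 1. *)
Inductive hterm : Type :=
| HGen of I
| HScal of R
| HAdd of hterm & hterm
| HMul of hterm & hterm.

Definition alt_word (i j : I) (n : nat) : seq I :=
  mkseq (fun k => if odd k then j else i) n.

Definition hterm_word (u : seq I) : hterm :=
  foldr (fun i x => HMul (HGen i) x) (HScal 1) u.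

Inductive hcongr : hterm -> hterm -> Prop :=
| HQuad i : hcongr
    (HMul (HAdd (HGen i) (HScal (- q))) (HAdd (HGen i) (HScal 1))) (HScal 0)
| HBraid i j : hcongr
    (hterm_word (alt_word i j (m i j))) (hterm_word (alt_word j i (m i j)))
| HScalD a b : hcongr (HScal (a + b)) (HAdd (HScal a) (HScal b))
| HScalM a b : hcongr (HScal (a * b)) (HMul (HScal a) (HScal b))
| HScalC a x : hcongr (HMul (HScal a) x) (HMul x (HScal a))
| HAddA x y z : hcongr (HAdd x (HAdd y z)) (HAdd (HAdd x y) z)
| HAddC x y : hcongr (HAdd x y) (HAdd y x)
| HAdd0 x : hcongr (HAdd (HScal 0) x) x
| HMulA x y z : hcongr (HMul x (HMul y z)) (HMul (HMul x y) z)
| HMul1 x : hcongr (HMul (HScal 1) x) x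
| HMul0 x : hcongr (HMul (HScal 0) x) (HScal 0)
| HMulDl x y z : hcongr (HMul (HAdd x y) z) (HAdd (HMul x z) (HMul y z))
| HMulDr x y z : hcongr (HMul x (HAdd y z)) (HAdd (HMul x y) (HMul x z))
| HCAdd x x' y y' : hcongr x x' -> hcongr y y' -> hcongr (HAdd x y) (HAdd x' y')
| HCMul x x' y y' : hcongr x x' -> hcongr y y' -> hcongr (HMul x y) (HMul x' y')
| HRefl x : hcongr x x
| HSym x y : hcongr x y -> hcongr y x
| HTrans x y z : hcongr x y -> hcongr y z -> hcongr x z.

HB.instance Definition _ := gen_eqMixin hterm.
HB.instance Definition _ := gen_choiceMixin hterm.

Definition hterm_eqv : rel hterm := fun x y => `[< hcongr x y >].

Lemma hterm_eqv_refl : reflexive hterm_eqv.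
Proof. by move=> x; apply/asboolP; apply: HRefl. Qed.

Lemma hterm_eqv_sym : symmetric hterm_eqv.
Proof. by move=> x y; apply/asboolP/asboolP; apply: HSym. Qed.

Lemma hterm_eqv_trans : transitive hterm_eqv.
Proof.
by move=> y x z /asboolP xy /asboolP yz; apply/asboolP; apply: HTrans xy yz.
Qed.

Canonical hterm_equiv :=
  EquivRel hterm_eqv hterm_eqv_refl hterm_eqv_sym hterm_eqv_trans.

Definition hecke := {eq_quot hterm_equiv}.

HB.instance Definition _ := Choice.on hecke.

Definition hclass (x : hterm) : hecke := \pi_hecke x.

Lemma hclassP x y : hclass x = hclass y <-> hcongr x y.
Proof.
split=> [/eqP|xy]; last by apply/eqP; rewrite eqmodE; apply/asboolP.
by rewrite /hclass eqmodE => /asboolP.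
Qed.

Lemma hclass_repr (x : hecke) : hclass (repr x) = x.
Proof. exact: reprK. Qed.

Definition hadd (x y : hecke) := hclass (HAdd (repr x) (repr y)).
Definition hmul (x y : hecke) := hclass (HMul (repr x) (repr y)).
Definition hscale (a : R) (x : hecke) := hclass (HMul (HScal a) (repr x)).
Definition hopp (x : hecke) := hscale (-1) x.

Lemma hclassD x y : hclass (HAdd x y) = hadd (hclass x) (hclass y).
Proof. by apply/hclassP; apply: HCAdd; apply/hclassP; rewrite hclass_repr. Qed.

Lemma hclassM x y : hclass (HMul x y) = hmul (hclass x) (hclass y).
Proof. by apply/hclassP; apply: HCMul; apply/hclassP; rewrite hclass_repr. Qed.

Lemma hscaleE a x : hscale a x = hmul (hclass (HScal a)) x.
Proof. by rewrite /hscale hclassM hclass_repr. Qed.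

Lemma hclass_ind (P : hecke -> Prop) : (forall x, P (hclass x)) -> forall x, P x.
Proof. by move=> PH x; rewrite -[x]hclass_repr. Qed.

Lemma haddA : associative hadd.
Proof.
elim/hclass_ind=> x; elim/hclass_ind=> y; elim/hclass_ind=> z.
by rewrite -!hclassD; apply/hclassP; apply: HAddA.
Qed.

Lemma haddC : commutative hadd.
Proof.
elim/hclass_ind=> x; elim/hclass_ind=> y.
by rewrite -!hclassD; apply/hclassP; apply: HAddC.
Qed.

Lemma hadd0 : left_id (hclass (HScal 0)) hadd.
Proof.
by elim/hclass_ind=> x; rewrite -!hclassD; apply/hclassP; apply: HAdd0.
Qed.

Lemma hmulA : associative hmul.
Proof.
elim/hclass_ind=> x; elim/hclass_ind=> y; elim/hclass_ind=> z.
by rewrite -!hclassM; apply/hclassP; apply: HMulA.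
Qed.

Lemma hscalC a x : hmul (hclass (HScal a)) x = hmul x (hclass (HScal a)).
Proof.
by elim/hclass_ind: x => x; rewrite -!hclassM; apply/hclassP; apply: HScalC.
Qed.

Lemma hmul1 : left_id (hclass (HScal 1)) hmul.
Proof.
by elim/hclass_ind=> x; rewrite -!hclassM; apply/hclassP; apply: HMul1.
Qed.

Lemma hmulr1 : right_id (hclass (HScal 1)) hmul.
Proof. by move=> x; rewrite -hscalC hmul1. Qed.

Lemma hmulDl : left_distributive hmul hadd.
Proof.
elim/hclass_ind=> x; elim/hclass_ind=> y; elim/hclass_ind=> z.
by rewrite -!(hclassD, hclassM); apply/hclassP; apply: HMulDl.
Qed.

Lemma hmulDr : right_distributive hmul hadd.
Proof.
elim/hclass_ind=> x; elim/hclass_ind=> y; elim/hclass_ind=> z.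
by rewrite -!(hclassD, hclassM); apply/hclassP; apply: HMulDr.
Qed.

Lemma hscalD a b :
  hclass (HScal (a + b)) = hadd (hclass (HScal a)) (hclass (HScal b)).
Proof. by rewrite -hclassD; apply/hclassP; apply: HScalD. Qed.

Lemma hscalM a b :
  hclass (HScal (a * b)) = hmul (hclass (HScal a)) (hclass (HScal b)).
Proof. by rewrite -hclassM; apply/hclassP; apply: HScalM. Qed.

Lemma haddN : left_inverse (hclass (HScal 0)) hopp hadd.
Proof.
move=> x; rewrite /hopp hscaleE -{2}[x]hmul1 -hmulDl -hscalD addNr.
by elim/hclass_ind: x => x; rewrite -hclassM; apply/hclassP; apply: HMul0.
Qed.

HB.instance Definition _ := GRing.isZmodule.Build hecke haddA haddC hadd0 haddN.

(* Nontriviality is witnessed by the character T_i |-> q. *)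
Fixpoint index_char (x : hterm) : R :=
  match x with
  | HGen _ => q
  | HScal a => a
  | HAdd x y => index_char x + index_char y
  | HMul x y => index_char x * index_char y
  end.

Lemma index_char_word u : index_char (hterm_word u) = q ^+ size u.
Proof. by elim: u => //= i u ->; rewrite exprS. Qed.

Lemma index_charP x y : hcongr x y -> index_char x = index_char y.
Proof.
elim=> //=.
- by move=> i; rewrite subrr mul0r.
- by move=> i j; rewrite !index_char_word !size_mkseq.
- by move=> *; rewrite mulrC.
- by move=> *; rewrite addrA.
- by move=> *; rewrite addrC.
- by move=> *; rewrite add0r.
- by move=> *; rewrite mulrA.
- by move=> *; rewrite mul1r.
- by move=> *; rewrite mul0r.
- by move=> *; rewrite mulrDl.
- by move=> *; rewrite mulrDr.
- by move=> x0 x' y0 y' _ -> _ ->.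
- by move=> x0 x' y0 y' _ -> _ ->.
- by move=> x0 y0 z0 _ -> _ ->.
Qed.

Lemma hone_neq0 : hclass (HScal 1) != 0.
Proof.
by apply/eqP=> /hclassP/index_charP /= /eqP; rewrite oner_eq0.
Qed.

HB.instance Definition _ := GRing.Zmodule_isNzRing.Build hecke
  hmulA hmul1 hmulr1 hmulDl hmulDr hone_neq0.

Lemma hscale_scale a b x : hscale a (hscale b x) = hscale (a * b) x.
Proof. by rewrite !hscaleE hscalM hmulA. Qed.

Lemma hscale1 : left_id 1 hscale.
Proof. by move=> x; rewrite hscaleE hmul1. Qed.

Lemma hscaleDr : right_distributive hscale +%R.
Proof. by move=> a x y; rewrite !hscaleE; apply: hmulDr. Qed.

Lemma hscaleDl x : {morph hscale^~ x : a b / a + b}.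
Proof. by move=> a b; rewrite /= !hscaleE hscalD; apply: hmulDl. Qed.

HB.instance Definition _ := GRing.Zmodule_isLmodule.Build R hecke
  hscale_scale hscale1 hscaleDr hscaleDl.

Lemma hscaleAl (a : R) (x y : hecke) : a *: (x * y) = a *: x * y.
Proof. by rewrite /GRing.scale /= !hscaleE; apply: hmulA. Qed.

HB.instance Definition _ := GRing.Lmodule_isLalgebra.Build R hecke hscaleAl.

Lemma hscaleAr (a : R) (x y : hecke) : a *: (x * y) = x * (a *: y).
Proof.
rewrite /GRing.scale /= !hscaleE /GRing.mul /=.
by rewrite hmulA hscalC -hmulA.
Qed.

HB.instance Definition _ := GRing.Lalgebra_isAlgebra.Build R hecke hscaleAr.

Definition hecke_gen (i : I) : hecke := hclass (HGen i).

(* By the braid relations (Matsumoto) the choice of reduced expression does not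
   matter. *)
Definition hecke_std (w : coxeter_group m) : hecke :=
  \prod_(i <- reduced_expr w) hecke_gen i.

End IwahoriHecke.

Section Span.

Variables (R : nzRingType) (M : lmodType R).

Definition linear_span (A : set M) : set M :=
  [set x | exists s : seq (R * M),
     (forall p, p \in s -> A p.2) /\ x = \sum_(p <- s) p.1 *: p.2].

End Span.

Definition left_eigenspace (R : nzRingType) (A : algType R) (t : A) (a : R) :
  set A := [set x | t * x = a *: x].

(* Laurent polynomials, as the subring kappa[v, v^-1] of kappa(v). *)
Section Laurent.

Variable kappa : fieldType.

Local Notation "p %:F" := (@tofrac _ p).

Definition is_laurent : {pred {fraction {poly kappa}}} :=
  fun f => `[< exists (p : {poly kappa}) (n : nat), f = p%:F / ('X%:F) ^+ n >].

Lemma fracX_neq0 : ('X : {poly kappa})%:F != 0.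
Proof. by rewrite tofrac_eq0 polyX_eq0. Qed.

Lemma is_laurent_subring : subring_closed is_laurent.
Proof.
split=> [|f g|f g].
- by apply/asboolP; exists 1, 0; rewrite tofrac1 divr1.
- move=> /asboolP[p [n ->]] /asboolP[r [k ->]]; apply/asboolP.
  exists (p * 'X^k - r * 'X^n), (n + k)%N.
  have nz e : ('X : {poly kappa})%:F ^+ e != 0 by rewrite expf_neq0 ?fracX_neq0.
  rewrite tofracB !tofracM !tofracXn exprD mulrBl invfM.
  congr (_ - _).
    by rewrite mulrACA divff ?mulr1.
  by rewrite [_^-1 * _]mulrC mulrACA divff ?mulr1.
- move=> /asboolP[p [n ->]] /asboolP[r [k ->]]; apply/asboolP.
  by exists (p * r), (n + k)%N; rewrite tofracM exprD invfM mulrACA.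
Qed.

HB.instance Definition _ :=
  GRing.isSubringClosed.Build {fraction {poly kappa}} is_laurent
    is_laurent_subring.

Record laurent := Laurent { laurent_val : {fraction {poly kappa}};
                            laurent_valP : laurent_val \in is_laurent }.

HB.instance Definition _ := gen_eqMixin laurent.
HB.instance Definition _ := gen_choiceMixin laurent.

Lemma laurent_val_inj : injective laurent_val.
Proof.
by move=> [f fP] [g gP] /= fg; subst g; rewrite (bool_irrelevance fP gP).
Qed.

(* The ring operations are those of the field of fractions; they are locked so
   that unification does not unfold the latter. *)
Fact laurent_key : unit. Proof. exact: tt. Qed.

Definition laurent0 := locked_with laurent_key (Laurent (rpred0 is_laurent)).
Definition laurent1 := locked_with laurent_key (Laurent (rpred1 is_laurent)).
Definition laurent_opp (x : laurent) := locked_with laurent_key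
  (Laurent (rpredNr (laurent_valP x))).
Definition laurent_add (x y : laurent) := locked_with laurent_key
  (Laurent (rpredD (laurent_valP x) (laurent_valP y))).
Definition laurent_mul (x y : laurent) := locked_with laurent_key
  (Laurent (rpredM (laurent_valP x) (laurent_valP y))).

Let val0 : laurent_val laurent0 = 0.
Proof. by rewrite /laurent0 unlock. Qed.
Let val1 : laurent_val laurent1 = 1.
Proof. by rewrite /laurent1 unlock. Qed.
Let valN x : laurent_val (laurent_opp x) = - laurent_val x.
Proof. by rewrite /laurent_opp unlock. Qed.
Let valD x y : laurent_val (laurent_add x y) = laurent_val x + laurent_val y.
Proof. by rewrite /laurent_add unlock. Qed.
Let valM x y : laurent_val (laurent_mul x y) = laurent_val x * laurent_val y.
Proof. by rewrite /laurent_mul unlock. Qed.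

Lemma laurent_addA : associative laurent_add.
Proof. by move=> x y z; apply: laurent_val_inj; rewrite !valD addrA. Qed.
Lemma laurent_addC : commutative laurent_add.
Proof. by move=> x y; apply: laurent_val_inj; rewrite !valD addrC. Qed.
Lemma laurent_add0 : left_id laurent0 laurent_add.
Proof. by move=> x; apply: laurent_val_inj; rewrite valD val0 add0r. Qed.
Lemma laurent_addN : left_inverse laurent0 laurent_opp laurent_add.
Proof. by move=> x; apply: laurent_val_inj; rewrite valD valN val0 addNr. Qed.
Lemma laurent_mulA : associative laurent_mul.
Proof. by move=> x y z; apply: laurent_val_inj; rewrite !valM mulrA. Qed.
Lemma laurent_mulC : commutative laurent_mul.
Proof. by move=> x y; apply: laurent_val_inj; rewrite !valM mulrC. Qed.
Lemma laurent_mul1 : left_id laurent1 laurent_mul.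
Proof. by move=> x; apply: laurent_val_inj; rewrite valM val1 mul1r. Qed.
Lemma laurent_mulDl : left_distributive laurent_mul laurent_add.
Proof.
by move=> x y z; apply: laurent_val_inj; rewrite !(valM, valD) mulrDl.
Qed.
Lemma laurent1_neq0 : laurent1 != laurent0.
Proof.
by apply/eqP=> /(congr1 laurent_val)/eqP; rewrite val1 val0 oner_eq0.
Qed.

HB.instance Definition _ := GRing.isZmodule.Build laurent
  laurent_addA laurent_addC laurent_add0 laurent_addN.
HB.instance Definition _ := GRing.Zmodule_isComNzRing.Build laurent
  laurent_mulA laurent_mulC laurent_mul1 laurent_mulDl laurent1_neq0.

Lemma laurent_val_zmod_morphism : zmod_morphism laurent_val.
Proof. by move=> x y; rewrite -valN -valD. Qed.

Lemma laurent_val_monoid_morphism : monoid_morphism laurent_val.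
Proof. by split=> [|x y]; [exact: val1 | exact: valM]. Qed.

HB.instance Definition _ := GRing.isZmodMorphism.Build
  laurent {fraction {poly kappa}} laurent_val laurent_val_zmod_morphism.
HB.instance Definition _ := GRing.isMonoidMorphism.Build
  laurent {fraction {poly kappa}} laurent_val laurent_val_monoid_morphism.

Definition laurent_unit : pred laurent := fun x => `[< exists y, y * x = 1 >].

Definition laurent_inv (x : laurent) : laurent :=
  xget x [set y | y * x = 1].

Lemma laurent_mulV : {in laurent_unit, left_inverse 1 laurent_inv *%R}.
Proof.
by move=> x /asboolP[y yx1]; rewrite /laurent_inv; case: xgetP => // /(_ y).
Qed.

Lemma laurent_unitP x y : y * x = 1 -> laurent_unit x.
Proof. by move=> yx1; apply/asboolP; exists y. Qed.

Lemma laurent_inv_out : {in [predC laurent_unit], laurent_inv =1 id}.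
Proof.
move=> x /asboolPn xU; rewrite /laurent_inv; case: xgetP => // y _ yx1.
by case: xU; exists y.
Qed.

HB.instance Definition _ := GRing.ComNzRing_hasMulInverse.Build laurent
  laurent_mulV laurent_unitP laurent_inv_out.

Lemma poly_is_laurent (p : {poly kappa}) : p%:F \in is_laurent.
Proof. by apply/asboolP; exists p, 0; rewrite divr1. Qed.

Definition laurent_poly (p : {poly kappa}) : laurent :=
  Laurent (poly_is_laurent p).

Definition lconst (c : kappa) : laurent := laurent_poly c%:P.
Definition lv : laurent := laurent_poly 'X.
Definition lq : laurent := lv ^+ 2.

Definition peval (p : {poly kappa}) (x : laurent) : laurent :=
  (map_poly lconst p).[x].

End Laurent.

Section KazhdanLusztig.

Variables (kappa : fieldType) (I : choiceType) (m : coxeter_matrix I).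

Local Notation Lambda := (laurent kappa).
Local Notation v := (lv kappa).
Local Notation q := (lq kappa).
Local Notation W := (coxeter_group m).
Local Notation H := (hecke (lq kappa) m).
Local Notation T := (@hecke_std Lambda q I m).
Local Notation l := (@cox_length I m).

(* A general element f(v) of Lambda is p(v) v^-n for some polynomial p. *)
Record is_bar_involution (bar : {rmorphism H -> H}) : Prop := {
  bar_bij : bijective bar;
  bar_scalar : forall (p : {poly kappa}) (n : nat),
    bar (peval p v * v ^- n)%:A = (peval p v^-1 * v^-1 ^- n)%:A;
  bar_std : forall w : W,
    bar (T w) * T w^-1%g = 1 /\ T w^-1%g * bar (T w) = 1 }.

(* \overline{P_{y,w}} is P_{y,w}(q^-1).  The interval [1, w] is finite, so the
   finitely supported sum below is the actual sum over y <= w. *)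
Definition is_KL_element (bar : {rmorphism H -> H}) (w : W) (c : H) : Prop :=
  bar c = c /\
  exists P : W -> {poly kappa},
    [/\ P w = 1,
        forall y, bruhat_lt y w -> ((size (P y)).-1.*2 <= l w - l y - 1)%N &
        c = \sum_(y \in [set y | bruhat_le y w])
              ((-1) ^+ l y * (-1) ^+ l w * v ^+ l w * q ^- l y
                 * peval (P y) q^-1) *: T y].

(* delta is a ring automorphism that fixes kappa; being of order two it is
   bijective, and it is not the identity since v is not fixed. *)
Record is_delta (delta : {rmorphism H -> H}) : Prop := {
  delta_order2 : involutive delta;
  delta_const : forall c : kappa, delta (lconst c)%:A = (lconst c)%:A;
  delta_gen : forall j : I,
    delta (v^-1 *: hecke_gen q m j) = v^-1 *: hecke_gen q m j;
  delta_v : delta v%:A = (- v^-1)%:A }.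

End KazhdanLusztig.

(* Main.v *)
Require Import Defs.
From HB Require Import structures.
From mathcomp Require Import all_boot all_order all_algebra.
From mathcomp Require Import boolp classical_sets.
From mathcomp Require Import cardinality fsbigop finmap.
From mathcomp Require Import algC cyclotomic.
From mathcomp Require Import zify ring.
From Stdlib Require Import Relation_Operators.

Set Implicit Arguments.
Unset Strict Implicit.
Unset Printing Implicit Defensive.

Import GRing.Theory.

Local Open Scope classical_set_scope.
Local Open Scope ring_scope.

(* For s = s_j and sw < w, the element x = v^-1 (T_s + 1) C_w is bar-invariant.
   Its coefficients satisfy x_{sy} = x_y, so an element y of maximal length in
   its support has sy < y, and then v^{l(y)} x_y lies in v kappa[v]; since bar
   is unitriangular for the length, v^{l(y)} x_y is also fixed by v -> v^-1,
   hence is 0.  Thus T_s C_w = -C_w.  Conversely, T_s x = -x means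
   x_y = -q x_{sy} for sy > y, so the elements of maximal length in the support
   of x have s as a left descent and can be removed by subtracting multiples of
   the C_w.  Finally delta exchanges the two eigenspaces, as delta(T_s) =
   -q^-1 T_s.

   This needs the basis T_w of the presented algebra: spanning is Matsumoto's
   theorem, and independence comes from the regular representation. *)

(** * The order of a product of two generators *)

Section GeometricRepresentation.

Variables (I : choiceType) (m : coxeter_matrix I).

(** The order is 2n because s_i s_j acts with eigenvalues z^2 and z^-2, which then have exact order
    n. The value 1 at n = 0, the code for infinity, makes this action unipotent. *)
Definition dihedral_root (n : nat) : algC :=
  if n is k.+1 then sval (C_prim_root_exists (isT : 0 < (k.+1).*2)%N) else 1.

Lemma dihedral_root_prim n :
  (0 < n)%N -> (n.*2).-primitive_root (dihedral_root n).
Proof. by case: n => // n _; apply: (svalP (C_prim_root_exists _)). Qed.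

Lemma dihedral_root_neq0 n : dihedral_root n != 0.
Proof.
case: n => [|n]; first exact: oner_neq0.
by have := prim_root_eq0 (@dihedral_root_prim n.+1 isT) => ->.
Qed.

(* For m_ij = n > 0 this is -2 cos(pi k / n) for some k prime to 2n; it equals 2
   on the diagonal and -2 when m_ij is infinite. *)
Definition cartan (i j : I) : algC :=
  - (dihedral_root (m i j) + (dihedral_root (m i j))^-1).

Lemma cartan_diag i : cartan i i = 2.
Proof.
rewrite /cartan coxeter_diag.
have xi2 := @dihedral_root_prim 1 isT.
have /eqP := prim_expr_order xi2; rewrite sqrf_eq1 => /orP[/eqP xi1|/eqP->].
  have := prim_order_dvd xi2 1; rewrite xi1 expr1n => /esym /=.
  by rewrite eqxx.
by rewrite invrN1 opprD opprK.
Qed.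

Lemma cartan_sym i j : cartan i j = cartan j i.
Proof. by rewrite /cartan coxeter_sym. Qed.

(* The contragredient of the geometric representation: it lives on all functions
   on I, so that no finiteness assumption on I or on supports is needed. *)
Definition refl_act (i : I) (f : I -> algC) : I -> algC :=
  fun k => f k - f i * cartan i k.

Definition word_act (u : seq I) (f : I -> algC) : I -> algC :=
  foldr refl_act f u.

Lemma word_act_cat u w f : word_act (u ++ w) f = word_act u (word_act w f).
Proof. exact: foldr_cat. Qed.

Lemma refl_actK i : involutive (refl_act i).
Proof.
by move=> f; apply: funext => k; rewrite /refl_act cartan_diag; ring.
Qed.

Definition dihedral_step (i j : I) (f : I -> algC) := refl_act i (refl_act j f).

Lemma word_act_alt i j n f :
  word_act (flatten (nseq n [:: i; j])) f = iter n (dihedral_step i j) f.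
Proof. by elim: n => //= n ->. Qed.

(** The functional f(i) + z f(j) is an eigenvector of the transpose of s_i s_j. The hypothesis is
    symmetric in z and z^-1, so each Cartan entry supplies two such functionals. *)
Lemma dihedral_step_eigen i j (z : algC) f :
  z != 0 -> cartan i j = - (z + z^-1) ->
  dihedral_step i j f i + z * dihedral_step i j f j = z ^+ 2 * (f i + z * f j).
Proof.
move=> z0 cE; rewrite /dihedral_step /refl_act !cartan_diag (cartan_sym j i) cE.
by field.
Qed.

Lemma iter_dihedral_step_eigen i j (z : algC) f n :
  z != 0 -> cartan i j = - (z + z^-1) ->
  let g := iter n (dihedral_step i j) f in
  g i + z * g j = z ^+ (n.*2) * (f i + z * f j).
Proof.
move=> z0 cE; elim: n => [|n IHn] /=; first by rewrite mul1r.
by rewrite dihedral_step_eigen // IHn mulrA -exprD.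
Qed.

Lemma coxeter_eq1 i j : m i j = 1%N -> i = j.
Proof.
by move=> mij; apply/eqP/negP => /negP/eqP/(@coxeter_offdiag _ m); rewrite mij.
Qed.

Lemma iter_dihedral_step i j f : iter (m i j) (dihedral_step i j) f = f.
Proof.
have [->//|m_gt0] := posnP (m i j).
have [m1|m_neq1] := eqVneq (m i j) 1%N.
  by rewrite m1 (coxeter_eq1 m1) /= /dihedral_step refl_actK.
have m_gt1 : (1 < m i j)%N by rewrite ltn_neqAle eq_sym m_neq1.
set z := dihedral_root (m i j); have z_prim := dihedral_root_prim m_gt0.
have z0 : z != 0 := dihedral_root_neq0 _.
have zP : z ^+ (m i j).*2 = 1 := prim_expr_order z_prim.
have zV0 : z^-1 != 0 by rewrite invr_eq0.
(* As m_ij > 1, the roots z and z^-1 differ, so their two eigenfunctionals are independent. *)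
have z2 : z ^+ 2 != 1.
  rewrite -(prim_order_dvd z_prim) -muln2 -{2}[2%N]mul1n dvdn_pmul2r //.
  by rewrite gtnNdvd.
have z2' : z ^+ 2 - 1 != 0 by rewrite subr_eq0.
have cE : cartan i j = - (z + z^-1) by [].
have cE' : cartan i j = - (z^-1 + z^-1^-1) by rewrite invrK addrC cE.
apply: funext => k.
(* [f k] corrected by a combination of the two eigenfunctionals is invariant. *)
pose inv g := g k + (cartan j k + z * cartan i k) * z / (z ^+ 2 - 1) ^+ 2
                      * (g i + z * g j)
  + (z * cartan j k + cartan i k) * z ^+ 2 / (z ^+ 2 - 1) ^+ 2
      * (g i + z^-1 * g j).
have invE g : inv (dihedral_step i j g) = inv g.
  rewrite /inv !dihedral_step_eigen //.
  rewrite /dihedral_step /refl_act (cartan_sym j i) cE.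
  by field; apply/andP.
have: inv (iter (m i j) (dihedral_step i j) f) = inv f.
  by elim: (m i j) => //= n <-.
rewrite /inv !iter_dihedral_step_eigen // exprVn zP invr1 !mul1r.
by move=> /addIr/addIr.
Qed.

Lemma word_act_congr u w : word_congr m u w -> word_act u =1 word_act w.
Proof.
elim=> [i j f|u1 u2 w1 w2 _ IHu _ IHw f|//|u1 u2 _ IH f|u1 u2 u3 _ IH1 _ IH2 f].
- by rewrite word_act_alt iter_dihedral_step.
- by rewrite !word_act_cat IHw IHu.
- by rewrite IH.
- by rewrite IH1 IH2.
Qed.

(** The step is unipotent: it fixes f(i) + f(j) and shifts f(i) by a constant multiple of it, so no
    positive power is trivial. *)
Lemma iter_dihedral_step_inf i j f n : m i j = 0%N ->
  let g := iter n (dihedral_step i j) f in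
  g i + g j = f i + f j /\ g i = f i - (f i + f j) *+ (n.*2).
Proof.
move=> m0; have cE : cartan i j = - 2 by rewrite /cartan m0 invr1.
elim: n => [|n [IH1 IH2]] /=; first by rewrite subr0.
set g := iter _ _ _ in IH1 IH2 *.
have <- : g i - (g i + g j) *+ 2 = f i - (f i + f j) *+ (n.*2).+2.
  by rewrite IH1 IH2 -[(n.*2).+2]addn2 [in RHS]mulrnDr [in RHS]opprD addrA.
rewrite -IH1 /dihedral_step /refl_act !cartan_diag (cartan_sym j i) cE.
by split; ring.
Qed.

Lemma alt_word_order i j n : i <> j -> (0 < n)%N ->
  word_congr m (flatten (nseq n [:: i; j])) [::] -> (0 < m i j <= n)%N.
Proof.
(* On the indicator of i the functional f(i) + z f(j) takes the value 1, so a trivial action forces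
   z^(2n) = 1. *)
move=> ij n_gt0 /word_act_congr; pose f k : algC := (k == i)%:R.
move/(_ f); rewrite word_act_alt /= => fE.
have fi : f i = 1 by rewrite /f eqxx.
have fj : f j = 0 by rewrite /f eq_sym; case: eqVneq.
have [m0|m_gt0] := posnP (m i j).
  have [_] := iter_dihedral_step_inf f n m0.
  rewrite fE fi fj addr0 => /eqP; rewrite -subr_eq0 opprB addrC subrK.
  by rewrite Num.Theory.pnatr_eq0 double_eq0 -leqn0 leqNgt n_gt0.
have := iter_dihedral_step_eigen f n (dihedral_root_neq0 (m i j)) (erefl _).
rewrite /= fE fi fj mulr0 addr0 mulr1 => /esym/eqP.
rewrite -(prim_order_dvd (dihedral_root_prim m_gt0)).
by rewrite -!muln2 dvdn_pmul2r //; apply: dvdn_leq.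
Qed.

End GeometricRepresentation.

(** * Exchange, Matsumoto's theorem and the Bruhat order *)

Section CoxeterCombinatorics.

Variables (I : choiceType) (m : coxeter_matrix I).

Local Notation W := (coxeter_group m).
Local Notation s := (cox_gen m).
Local Notation cw := (cox_word m).
Local Notation l := (@cox_length I m).

Lemma cox_wordD u w : cw (u ++ w) = (cw u * cw w)%g.
Proof. by rewrite -cox_word_cat. Qed.

Lemma cox_word_cons i u : cw (i :: u) = (s i * cw u)%g.
Proof. exact: (cox_wordD [:: i]). Qed.

Lemma cox_word_nil : cw [::] = 1%g.
Proof. by []. Qed.

Lemma cox_word_rev u : cw (rev u) = (cw u)^-1%g.
Proof.
apply: (mulIg (cw u)); rewrite mulVg -cox_wordD.
by apply/cox_wordP; apply: word_congr_rev.
Qed.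

Lemma cox_genV i : ((s i)^-1 = s i)%g.
Proof. by rewrite -cox_word_rev. Qed.

Lemma cox_gen2 i : (s i * s i = 1)%g.
Proof. by rewrite -{1}cox_genV mulVg. Qed.

Lemma cox_genK i : involutive (fun w : W => s i * w)%g.
Proof. by move=> w; rewrite mulgA cox_gen2 mul1g. Qed.

Lemma cox_genKr i w : (w * s i * s i = w)%g.
Proof. by rewrite -mulgA cox_gen2 mulg1. Qed.

Lemma cox_length_le u : (l (cw u) <= size u)%N.
Proof.
rewrite /cox_length; case: ex_minnP => n _; apply.
by apply/asboolP; exists u; rewrite -cox_word_prod.
Qed.

Lemma cox_length_ex w : exists u, size u = l w /\ cw u = w.
Proof.
rewrite /cox_length; case: ex_minnP => n /asboolP[u [<- uw]] _.
by exists u; rewrite cox_word_prod.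
Qed.

Lemma word_congr_odd_size u w : word_congr m u w -> odd (size u) = odd (size w).
Proof.
elim=> [i j|u1 u2 w1 w2 _ IHu _ IHw|//|//|u1 u2 u3 _ -> _ ->//].
  by rewrite size_flatten /shape map_nseq sumn_nseq /= mul2n odd_double.
by rewrite !size_cat !oddD IHu IHw.
Qed.

Lemma odd_cox_length u : odd (l (cw u)) = odd (size u).
Proof.
have [w [<- /cox_wordP]] := cox_length_ex (cw u).
exact: word_congr_odd_size.
Qed.

Lemma cox_lengthV w : l w^-1%g = l w.
Proof.
have le_l x : (l x^-1%g <= l x)%N.
  have [u [<- <-]] := cox_length_ex x.
  by rewrite -cox_word_rev -(size_rev u); apply: cox_length_le.
by apply/eqP; rewrite eqn_leq le_l -{1}[w]invgK le_l.
Qed.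

(** The lengths differ by at most 1, and every relation preserves the parity of word size, which
    excludes equality. *)
Lemma cox_length_genl i w :
  (l (s i * w)%g == (l w).+1) || (l w == (l (s i * w)%g).+1).
Proof.
have le_l x : (l (s i * x)%g <= (l x).+1)%N.
  have [u [<- <-]] := cox_length_ex x.
  by rewrite -cox_word_cons; apply: cox_length_le.
have := le_l w; have := le_l (s i * w)%g; rewrite cox_genK.
have : odd (l (s i * w)%g) = ~~ odd (l w).
  have [u [_ <-]] := cox_length_ex w.
  by rewrite -cox_word_cons !odd_cox_length.
lia.
Qed.

Lemma cox_length_genr i w :
  (l (w * s i)%g == (l w).+1) || (l w == (l (w * s i)%g).+1).
Proof.
rewrite -(cox_lengthV w) -(cox_lengthV (w * s i)%g) invgM cox_genV.
exact: cox_length_genl.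
Qed.

Lemma cox_length_descent i w :
  (l w < l (s i * w)%g)%N = ~~ (l (s i * w)%g < l w)%N.
Proof. by have := cox_length_genl i w; lia. Qed.

Lemma alt_word_cons (i j : I) n : alt_word i j n.+1 = i :: alt_word j i n.
Proof.
rewrite /alt_word /mkseq /= -[1%N]addn0 iotaDl -map_comp; congr (_ :: _).
by apply: eq_map => k /=; case: odd.
Qed.

Lemma size_alt_word (i j : I) n : size (alt_word i j n) = n.
Proof. exact: size_mkseq. Qed.

Lemma alt_word_double (i j : I) n :
  alt_word i j n.*2 = flatten (nseq n [:: i; j]).
Proof. by elim: n => //= n IHn; rewrite !alt_word_cons IHn. Qed.

Lemma cox_word_alt_double i j n : cw (alt_word i j n.*2) = ((s i * s j) ^+ n)%g.
Proof.
elim: n => // n IHn.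
by rewrite doubleS !alt_word_cons !cox_word_cons IHn expgS mulgA.
Qed.

Lemma expg_gen_comm i j n :
  (s i * (s j * s i) ^+ n = (s i * s j) ^+ n * s i)%g.
Proof.
elim: n => [|n IHn]; first by rewrite mulg1 mul1g.
by rewrite expgSr mulgA IHn expgSr !mulgA.
Qed.

(** At n = m_ij the power is trivial, which turns the order relation into the braid relation. *)
Lemma cox_word_alt_swap i j n :
  ((s i * s j) ^+ n * cw (alt_word j i n))%g = cw (alt_word i j n).
Proof.
elim: n i j => [|n IHn] i j; first by rewrite mul1g.
rewrite !alt_word_cons !cox_word_cons -(IHn j i) [RHS]mulgA expg_gen_comm.
by rewrite expgSr !mulgA cox_genKr.
Qed.

Lemma cox_gen_prod_expg i j : ((s i * s j) ^+ m i j = 1)%g.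
Proof.
rewrite -cox_word_alt_double alt_word_double; apply/cox_wordP.
exact: WRel.
Qed.

Lemma cox_word_braid i j : cw (alt_word i j (m i j)) = cw (alt_word j i (m i j)).
Proof. by rewrite -cox_word_alt_swap cox_gen_prod_expg mul1g. Qed.

(* The reflections s_1 ... s_k s_(k+1) s_k ... s_1 of the word s_1 s_2 ... *)
Fixpoint refl_seq (u : seq I) : seq W :=
  if u is i :: u' then s i :: [seq (s i * t * s i)%g | t <- refl_seq u']
  else [::].

Lemma size_refl_seq u : size (refl_seq u) = size u.
Proof. by elim: u => //= i u <-; rewrite size_map. Qed.

Lemma refl_seq_cat u w :
  refl_seq (u ++ w)
    = refl_seq u ++ [seq (cw u * t * (cw u)^-1)%g | t <- refl_seq w].
Proof.
elim: u => [|i u IHu] /=.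
  rewrite -[LHS]map_id; apply: eq_map => t /=.
  by rewrite cox_word_nil mul1g invg1 mulg1.
rewrite IHu map_cat -map_comp; congr (_ :: _ ++ _); apply: eq_map => t /=.
by rewrite cox_word_cons invgM cox_genV !mulgA.
Qed.

Lemma refl_seq_alt i j n :
  refl_seq (alt_word i j n) = [seq ((s i * s j) ^+ k * s i)%g | k <- iota 0 n].
Proof.
elim: n i j => // n IHn i j; rewrite alt_word_cons /= IHn mul1g.
rewrite -[1%N]addn0 iotaDl -!map_comp; congr (_ :: _); apply: eq_map => k /=.
by rewrite !mulgA expg_gen_comm expgSr !mulgA.
Qed.

(** The sign cocycle of the group on reflections. Unlike the list [refl_seq u], this parity depends
    only on the element that u represents. *)
Definition refl_parity (u : seq I) (t : W) : bool :=
  odd (count_mem t (refl_seq u)).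

Lemma refl_parity_cat u w t :
  refl_parity (u ++ w) t
    = refl_parity u t (+) refl_parity w ((cw u)^-1 * t * cw u)%g.
Proof.
rewrite /refl_parity refl_seq_cat count_cat oddD count_map; congr (_ (+) odd _).
apply: eq_count => x /=; apply/eqP/eqP => [<-|->].
  by rewrite !mulgA mulVg mul1g mulgVK.
by rewrite !mulgA mulgV mul1g mulgK.
Qed.

(** The list has 2 m_ij terms, and its second half repeats the first because (s_i s_j)^m_ij = 1. *)
Lemma refl_parity_rel i j t :
  refl_parity (flatten (nseq (m i j) [:: i; j])) t = false.
Proof.
rewrite /refl_parity -alt_word_double refl_seq_alt -addnn iotaD map_cat count_cat.
rewrite add0n -{2}[m i j]addn0 iotaDl -map_comp.
rewrite (@eq_map _ _ _ (fun k => (s i * s j) ^+ k * s i)%g) ?addnn ?odd_double //.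
by move=> k /=; rewrite expgnDr cox_gen_prod_expg mul1g.
Qed.

Lemma refl_parity_congr u w :
  word_congr m u w -> refl_parity u =1 refl_parity w.
Proof.
elim=> [i j t|u1 u2 w1 w2 /cox_wordP uE IHu _ IHw t|//|u1 u2 _ IH t|].
- by rewrite refl_parity_rel.
- by rewrite !refl_parity_cat IHu IHw uE.
- by rewrite IH.
- by move=> u1 u2 u3 _ IH1 _ IH2 t; rewrite IH1 IH2.
Qed.

Lemma refl_seq_deletion t u : t \in refl_seq u ->
  exists u', [/\ size u = (size u').+1, subseq u' u & cw u' = (t * cw u)%g].
Proof.
elim: u t => //= i u IHu t; rewrite inE => /orP[/eqP->|/mapP[x /IHu[u' []]]].
  exists u; split=> //; first exact: (subseq_cons u i).
  by rewrite cox_word_cons cox_genK.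
move=> szu u'u cu' ->; exists (i :: u'); split => //=.
- by rewrite szu.
- by rewrite eqxx.
- by rewrite !cox_word_cons cu' -!mulgA cox_genK.
Qed.

Lemma refl_seq_length_lt t u : t \in refl_seq u -> (l (t * cw u)%g < size u)%N.
Proof.
by move=> /refl_seq_deletion[u' [-> _ <-]]; rewrite ltnS; apply: cox_length_le.
Qed.

Lemma refl_parity_mem u t : refl_parity u t -> t \in refl_seq u.
Proof. by move=> /odd_gt0; rewrite -has_count has_pred1. Qed.

(** The reflection is represented by a palindrome v i v^-1. The contributions of v and its reverse
    cancel, since together they form a trivial word, and the middle letter contributes 1. *)
Lemma refl_parity_reflection u : reflection (cw u) -> refl_parity u (cw u).
Proof.
case=> x [i uE]; have [v [_ vx]] := cox_length_ex x.
have ue : word_congr m u (v ++ i :: rev v).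
  apply/cox_wordP; rewrite uE cox_wordD cox_word_cons cox_word_rev vx.
  by rewrite mulgA.
have conj_u : (x^-1 * cw u * x)%g = s i.
  by rewrite uE !mulgA mulVg mul1g mulgVK.
have := refl_parity_cat v (rev v) (cw u); rewrite vx conj_u.
have -> : refl_parity (v ++ rev v) (cw u) = false.
  rewrite (@refl_parity_congr _ [::]) //; apply/cox_wordP.
  by rewrite cox_wordD cox_word_rev mulgV.
rewrite (refl_parity_congr ue) refl_parity_cat vx conj_u -cat1s refl_parity_cat.
rewrite cox_genV cox_gen2 mul1g /= [refl_parity [:: i] _]/refl_parity /= eqxx.
by case: refl_parity; case: refl_parity.
Qed.

Lemma reflection_sqr t : reflection t -> (t * t = 1 :> W)%g.
Proof.
by case=> x [i ->]; rewrite -!mulgA mulKg cox_genK mulgV.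
Qed.

Lemma reflection_gen i : reflection (s i).
Proof. by exists 1%g, i; rewrite mul1g invg1 mulg1. Qed.

(** Let v be a word for t. If t had even parity in u, it would have odd parity in [v ++ u], hence
    occur for a reduced word of tu; multiplying tu by t would then shorten it, making u shorter than
    tu. *)
Theorem strong_exchange t u :
  reflection t -> (l (t * cw u)%g < l (cw u))%N -> t \in refl_seq u.
Proof.
move=> tR lt_tu; apply: refl_parity_mem; apply: contraLR lt_tu => /negPf ut.
rewrite -leqNgt; have [v [_ vt]] := cox_length_ex t.
have [u' [sz_u' u'E]] := cox_length_ex (t * cw u)%g.
have : refl_parity (v ++ u) t.
  rewrite refl_parity_cat vt mulVg mul1g ut addbF -vt.
  by apply: refl_parity_reflection; rewrite vt.
rewrite (@refl_parity_congr _ u'); last by apply/cox_wordP; rewrite cox_wordD vt.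
move=> /refl_parity_mem/refl_seq_length_lt.
by rewrite u'E mulgA reflection_sqr // mul1g sz_u' => /ltnW.
Qed.

(** Without repetitions every listed reflection has odd parity, so it is listed for each word of the
    same element, and no such word can be shorter. *)
Lemma uniq_refl_seq_length u : uniq (refl_seq u) -> l (cw u) = size u.
Proof.
move=> u_uniq; apply/eqP; rewrite eqn_leq cox_length_le /=.
have [w [<- wE]] := cox_length_ex (cw u).
rewrite -(size_refl_seq u) -(size_refl_seq w); apply: uniq_leq_size => // t tu.
apply: refl_parity_mem; rewrite (@refl_parity_congr _ u); last exact/cox_wordP.
by rewrite /refl_parity count_uniq_mem // tu.
Qed.

Lemma cox_gen_prod_order i j n : i <> j -> (0 < n)%N ->
  ((s i * s j) ^+ n = 1)%g -> (0 < m i j <= n)%N.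
Proof.
move=> ij n_gt0; rewrite -cox_word_alt_double alt_word_double -cox_word_nil.
by move=> /cox_wordP; apply: alt_word_order.
Qed.

Lemma alt_word_length i j n :
  i <> j -> (n <= m i j)%N -> l (cw (alt_word i j n)) = n.
Proof.
move=> ij le_n; rewrite uniq_refl_seq_length ?size_alt_word //.
rewrite refl_seq_alt map_inj_in_uniq ?iota_uniq // => a b.
rewrite !mem_iota /= !add0n.
wlog: a b / (a <= b)%N => [IH|].
  by case: (leqP a b) => [/IH //|/ltnW/IH {}IH ? ? /esym/IH ->].
rewrite leq_eqVlt => /orP[/eqP//|lt_ab] _ lt_bn /mulIg.
rewrite -(subnKC lt_ab) addSnnS expgnDr => /eqP; rewrite -{1}[(_ ^+ a)%g]mulg1.
rewrite (inj_eq (mulgI _)) => /eqP/esym/(cox_gen_prod_order ij (ltn0Sn _)).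
lia.
Qed.

Lemma descent_word i w : (l (s i * w)%g < l w)%N ->
  exists r, l w = (size r).+1 /\ cw (i :: r) = w.
Proof.
move=> lt_w; have [u [szu uw]] := cox_length_ex w.
have := strong_exchange (reflection_gen i) (u := u); rewrite uw => /(_ lt_w).
move=> /refl_seq_deletion[r [szr _ rE]]; exists r.
by rewrite -szu szr cox_word_cons rE cox_genK uw.
Qed.

(** Exchange puts i in front of a word that starts with an alternating block from j. The deleted
    letter lies in the tail r: a deletion inside the block would give s_j s_i an order below
    m_ij. *)
Lemma two_descents_word i j w n : i <> j ->
  (l (s i * w)%g < l w)%N -> (l (s j * w)%g < l w)%N ->
  m i j = 0%N \/ (n < m i j)%N ->
  exists r, l w = (n.+1 + size r)%N /\ cw (alt_word i j n.+1 ++ r) = w.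
Proof.
elim: n i j => [|n IHn] i j ij si sj nm.
  have [r [szr rw]] := descent_word si; exists r.
  by rewrite alt_word_cons.
have [|r [szr rw]] := IHn j i (nesym ij) sj si.
  by rewrite coxeter_sym; lia.
have := strong_exchange (reflection_gen i) (u := alt_word j i n.+1 ++ r).
rewrite rw => /(_ si); rewrite refl_seq_cat mem_cat => /orP[|].
  rewrite refl_seq_alt => /mapP[k]; rewrite mem_iota /= add0n => lt_k.
  move=> /(congr1 (fun x => x * s i)%g); rewrite cox_gen2 -mulgA -expgSr.
  move=> /esym/(cox_gen_prod_order (nesym ij) (ltn0Sn k)).
  by rewrite coxeter_sym; lia.
move=> /mapP[t /refl_seq_deletion[r' [szr' _ r'E]] sE].
exists r'; split; first by rewrite szr szr' addnS.
have At : (cw (alt_word j i n.+1) * t = s i * cw (alt_word j i n.+1))%g.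
  by rewrite sE mulgVK.
rewrite alt_word_cons cat_cons cox_word_cons cox_wordD r'E.
by rewrite (mulgA (cw (alt_word j i _)) t) At -mulgA cox_genK -cox_wordD rw.
Qed.

(** Induction on length. Equal first letters cancel. Otherwise i and j are both descents, and the
    element has two reduced words formed by an alternating block of length m_ij, from i or from j,
    and a common tail; the braid move joins these, and each shares its head with one of the given
    words. *)
Theorem matsumoto (X : Type) (f : seq I -> X) :
  (forall i u w, f u = f w -> f (i :: u) = f (i :: w)) ->
  (forall i j r, f (alt_word i j (m i j) ++ r) = f (alt_word j i (m i j) ++ r)) ->
  forall u w, size u = l (cw u) -> size w = l (cw w) -> cw u = cw w -> f u = f w.
Proof.
move=> f_cons f_braid u w; move: {2}(size u) (erefl (size u)) => n.
elim: n u w => [|n IHn] [|i u] [|j w] //=.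
- by move=> _ uR wR uw; rewrite -uw -uR in wR.
- by move=> _ uR wR uw; rewrite uw -wR in uR.
move=> [szu] uR wR uw.
have tail_red k x : (size x).+1 = l (cw (k :: x)) ->
    (size x = l (cw x) /\ (l (s k * cw (k :: x))%g < l (cw (k :: x)))%N).
  move=> xR; have := cox_length_le x; have := cox_length_genl k (cw x).
  by rewrite cox_word_cons cox_genK -cox_word_cons -xR; lia.
have same_head k x y : (size x).+1 = l (cw (k :: x)) -> size x = n ->
    (size y).+1 = l (cw (k :: y)) -> cw (k :: x) = cw (k :: y) ->
    f (k :: x) = f (k :: y).
  move=> xR xn yR; rewrite !cox_word_cons => /mulgI xy; apply: f_cons.
  by apply: IHn => //; [case: (tail_red _ _ xR) | case: (tail_red _ _ yR)].
have [ij|/eqP ij] := eqVneq i j.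
  by rewrite -ij in uw wR *; apply: same_head.
have [_ di] := tail_red _ _ uR; have [_ dj] := tail_red _ _ wR.
rewrite -uw in dj.
have [m0|m_gt0] := posnP (m i j).
  (* If m_ij is infinite, two descents would allow an alternating block longer than the element
     itself. *)
  have [|r [lE _]] := two_descents_word (n := l (cw (i :: u))) ij di dj.
    by left.
  by lia.
have [|r [lE rE]] := two_descents_word (n := (m i j).-1) ij di dj.
  by right; rewrite ltn_predL.
have rE' : cw (alt_word j i (m i j) ++ r) = cw (i :: u).
  by rewrite -rE (prednK m_gt0) !cox_wordD cox_word_braid.
rewrite (prednK m_gt0) in lE rE.
have := f_braid i j r; case: (m i j) m_gt0 lE rE rE' => // k _.
rewrite !alt_word_cons /= => lE rE rE' fE.
rewrite (same_head i u (alt_word j i k ++ r)) ?fE //.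
- apply/esym/same_head => //; last by rewrite rE' uw.
    by apply: succn_inj; rewrite wR -uw -uR szu.
  by rewrite rE' lE size_cat size_alt_word.
- by rewrite rE lE size_cat size_alt_word.
Qed.

End CoxeterCombinatorics.

(** * The diamond lemma and finiteness of Bruhat intervals *)

Section BruhatOrder.

Variables (I : choiceType) (m : coxeter_matrix I).

Local Notation W := (coxeter_group m).
Local Notation s := (cox_gen m).
Local Notation cw := (cox_word m).
Local Notation l := (@cox_length I m).

Lemma cox_length1 : l 1%g = 0%N.
Proof. by apply/eqP; rewrite -leqn0; apply: (cox_length_le m [::]). Qed.

Lemma cox_ind (P : W -> Prop) : P 1%g ->
  (forall i w, (l w < l (s i * w)%g)%N -> P w -> P (s i * w)%g) ->
  forall w, P w.
Proof.
move=> P1 Ps w; have [u [uR uw]] := cox_length_ex w; rewrite -{w}uw in uR *.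
elim: u uR => [|i u IHu] //=; rewrite cox_word_cons => uR.
have := cox_length_genl i (cw u); have := cox_length_le m u; rewrite -uR => le_u lu.
by apply: Ps; [rewrite -uR; lia | apply: IHu; lia].
Qed.

(** Exchange in [u ++ [:: j]], with u reduced for w, must delete the last letter: a reflection of u
    itself would make s_i w shorter than w. *)
Lemma cox_diamond i j w :
  (l w < l (s i * w)%g)%N -> (l (s i * w * s j)%g < l (w * s j)%g)%N ->
  (s i * w = w * s j)%g.
Proof.
move=> lt_w; have [u [szu uw]] := cox_length_ex w; rewrite -uw in szu lt_w *.
rewrite -mulgA -[s j]/(cw [:: j]) -cox_wordD.
move=> /(strong_exchange (reflection_gen _ _)); rewrite refl_seq_cat mem_cat.
case/orP=> [/refl_seq_length_lt|].
  by rewrite szu ltnNge ltnW.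
by rewrite /= inE => /eqP->; rewrite mulgVK cox_wordD.
Qed.

Lemma bruhat_step_subword y u : bruhat_step y (cw u) ->
  exists u', subseq u' u /\ cw u' = y.
Proof.
case=> t [tR wE lt_yw]; have tt := reflection_sqr tR.
(* Exchange concerns left multiplication, so the right factor t is replaced by its conjugate by
   y. *)
pose t' := (y * t * y^-1)%g.
have t'R : reflection t'.
  case: tR => x [i tE]; exists (y * x)%g, i.
  by rewrite /t' tE invgM !mulgA.
have t'w : (t' * cw u = y)%g.
  by rewrite wE /t' mulgA mulgVK -mulgA tt mulg1.
have := strong_exchange (u := u) t'R; rewrite t'w => /(_ lt_yw).
case/refl_seq_deletion=> u' [_ u'u u'E]; exists u'.
by rewrite u'E t'w.
Qed.

Lemma bruhat_subword y u : bruhat_le y (cw u) ->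
  exists u', subseq u' u /\ cw u' = y.
Proof.
set w := cw u => yw; have : cw u = w by []; move: w yw => w yw.
elim: {y w} yw u => [y w yw|y|y x w _ IH1 _ IH2] u uw.
- by apply: bruhat_step_subword; rewrite uw.
- by exists u.
- have [u' [u'u u'x]] := IH2 _ uw; have [u2 [u2u' u2y]] := IH1 _ u'x.
  by exists u2; rewrite u2y (subseq_trans u2u').
Qed.

(** Each element below w is given by a mask of one fixed word for w. Finiteness makes the sum that
    defines a Kazhdan-Lusztig element a genuine one. *)
Lemma bruhat_interval_finite w : finite_set [set y | @bruhat_le I m y w].
Proof.
have [u [_ uw]] := cox_length_ex w.
apply: (@sub_finite_set _ _
  [set` [seq cw (mask b u) | b : (size u).-tuple bool]]); last exact: finite_seq.
move=> y /=; rewrite -uw => /bruhat_subword[_ [/subseqP[b szb ->] <-]].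
by apply/mapP; exists (Tuple (introT eqP szb)); rewrite ?mem_enum.
Qed.

Lemma bruhat_le_length y w : @bruhat_le I m y w -> y = w \/ (l y < l w)%N.
Proof.
elim=> [{}y {}w [t [_ _ lt_yw]]|{}y|{}y x {}w _ IH1 _ IH2]; [by right|by left|].
case: IH1 IH2 => [->//|lt_yx] [<-|lt_xw]; first by right.
by right; apply: ltn_trans lt_xw.
Qed.

Lemma bruhat_lt_length y w : @bruhat_lt I m y w -> (l y < l w)%N.
Proof. by case=> /bruhat_le_length[]. Qed.

Lemma bruhat_lt_genl i w :
  bruhat_lt (s i * w)%g w <-> (l (s i * w)%g < l w)%N.
Proof.
split=> [/bruhat_lt_length //|lt_w]; split; last first.
  by move=> /(congr1 l) E; rewrite E ltnn in lt_w.
apply: rt_step; exists (w^-1 * s i * w)%g; split=> //.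
  by exists w^-1%g, i; rewrite invgK.
by rewrite !mulgA mulgK cox_gen2 mul1g.
Qed.

End BruhatOrder.

(** * The standard basis of the Hecke algebra *)

Section HeckeBasis.

Variables (R : comNzRingType) (q : R) (I : choiceType) (m : coxeter_matrix I).

Local Notation W := (coxeter_group m).
Local Notation s := (cox_gen m).
Local Notation cw := (cox_word m).
Local Notation l := (@cox_length I m).
Local Notation H := (hecke q m).
Local Notation g := (hecke_gen q m).
Local Notation T := (@hecke_std R q I m).

Lemma hclass_scal a : hclass q m (HScal I a) = a%:A.
Proof. by rewrite /GRing.scale /= hscaleE [LHS](esym (hmulr1 _)). Qed.

Lemma hclass_add x y : hclass q m (HAdd x y) = hclass q m x + hclass q m y.
Proof. exact: hclassD. Qed.

Lemma hclass_mul x y : hclass q m (HMul x y) = hclass q m x * hclass q m y.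
Proof. exact: hclassM. Qed.

Lemma hecke_gen_sqr i : g i * g i = (q - 1) *: g i + q%:A.
Proof.
have /hclassP := HQuad q m i.
rewrite hclass_mul !hclass_add !hclass_scal scale0r scale1r -/(g i).
rewrite mulrDl !mulrDr !mulr1 -scalerAl mul1r => E; apply: subr0_eq.
rewrite -E scalerBl scale1r !opprD opprK !scaleNr !addrA.
by congr (_ + _); rewrite addrAC.
Qed.

Definition hecke_word (u : seq I) : H := \prod_(i <- u) g i.

Lemma hecke_wordE u : hecke_word u = hclass q m (hterm_word R u).
Proof.
rewrite /hecke_word; elim: u => [|i u IHu] /=.
  by rewrite big_nil hclass_scal scale1r.
by rewrite big_cons IHu hclass_mul.
Qed.

Lemma hecke_word_reduced u w :
  size u = l (cw u) -> size w = l (cw w) -> cw u = cw w ->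
  hecke_word u = hecke_word w.
Proof.
apply: matsumoto => [i x y xy|i j r].
  by rewrite /hecke_word !big_cons -!/(hecke_word _) xy.
rewrite /hecke_word !big_cat -!/(hecke_word _) /=; congr (_ * _).
by rewrite !hecke_wordE; apply/hclassP; apply: HBraid.
Qed.

Lemma hecke_std_word u : size u = l (cw u) -> T (cw u) = hecke_word u.
Proof.
move=> uR; rewrite /hecke_std; set r := reduced_expr _.
have /asboolP[szr rE] : is_reduced_expr (cw u) r by apply: xchooseP.
rewrite -/(hecke_word r); rewrite -cox_word_prod in rE.
by apply: hecke_word_reduced; rewrite ?rE.
Qed.

Lemma hecke_std1 : T 1%g = 1.
Proof.
by rewrite -(cox_word_nil m) hecke_std_word ?cox_length1 // /hecke_word big_nil.
Qed.

Lemma hecke_gen_std_up i w : (l w < l (s i * w)%g)%N -> g i * T w = T (s i * w)%g.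
Proof.
move=> lt_w; have [u [szu uw]] := cox_length_ex w.
have := cox_length_genl i w; rewrite -uw -cox_word_cons in szu lt_w * => sz_iu.
rewrite !hecke_std_word //=; last by rewrite szu; lia.
by rewrite /hecke_word big_cons.
Qed.

Lemma hecke_gen_std_down i w : (l (s i * w)%g < l w)%N ->
  g i * T w = (q - 1) *: T w + q *: T (s i * w)%g.
Proof.
move=> lt_w; have := @hecke_gen_std_up i (s i * w)%g; rewrite cox_genK.
move=> /(_ lt_w) <-; rewrite mulrA hecke_gen_sqr mulrDl -scalerAl.
by rewrite -scalerAl mul1r.
Qed.

Lemma hecke_std_gen i : T (s i) = g i.
Proof.
have le1 : (l (s i) <= 1)%N := cox_length_le m [:: i].
have odd1 : odd (l (s i)) := odd_cox_length m [:: i].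
rewrite (@hecke_std_word [:: i]); last first.
  by move: le1 odd1; rewrite -[s i]/(cw [:: i]); case: (l _) => [|[|]].
by rewrite /hecke_word big_cons big_nil mulr1.
Qed.

(* The transposes of left and right multiplication by T_s in the would-be basis
   T_w, acting on all functions on W, read as coordinate functionals. *)
Definition ldual (i : I) (f : W -> R) : W -> R := fun w =>
  if (l w < l (s i * w)%g)%N then f (s i * w)%g
  else (q - 1) * f w + q * f (s i * w)%g.

Definition rdual (j : I) (f : W -> R) : W -> R := fun w =>
  if (l w < l (w * s j)%g)%N then f (w * s j)%g
  else (q - 1) * f w + q * f (w * s j)%g.

Lemma ldual_rdual i j f : ldual i (rdual j f) = rdual j (ldual i f).
Proof.
apply: funext => w; rewrite /ldual /rdual !mulgA.
have d1 := @cox_diamond _ m i j w.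
have d2 := @cox_diamond _ m i j (s i * w)%g; rewrite cox_genK in d2.
have := cox_length_genl i w; have := cox_length_genr j w.
have := cox_length_genl i (w * s j)%g; have := cox_length_genr j (s i * w)%g.
rewrite !mulgA.
move: d1 d2; set a := l w; set b := l (s i * w)%g; set c := l (w * s j)%g.
set d := l (s i * w * s j)%g.
case: (ltnP a b) => h1; case: (ltnP a c) => h2; case: (ltnP b d) => h3;
case: (ltnP c d) => h4;
  move=> d1 d2 e1 e2 e3 e4; try (by exfalso; clear d1 d2; lia); try ring.
(* In the two remaining cases w and s_i w s_j are both shorter, or both longer, than s_i w and w
   s_j; the diamond lemma gives s_i w = w s_j. *)
- by rewrite d1 //; lia.
- suff -> : (w * s j = s i * w)%g by [].
  by rewrite {1}d2 ?cox_genKr //; lia.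
Qed.

(** Products act in reversed order because transposition turns the left action into a right one. *)
Fixpoint hdual_term (x : hterm R I) (f : W -> R) : W -> R :=
  match x with
  | HGen i => ldual i f
  | HScal a => fun w => a * f w
  | HAdd x y => fun w => hdual_term x f w + hdual_term y f w
  | HMul x y => hdual_term y (hdual_term x f)
  end.

Lemma hdual_term_lin x a b f f' :
  hdual_term x (fun w => a * f w + b * f' w)
    = fun w => a * hdual_term x f w + b * hdual_term x f' w.
Proof.
elim: x f f' => [i|c|x IHx y IHy|x IHx y IHy] f f' /=; last by rewrite IHx IHy.
- by apply: funext => w; rewrite /ldual; case: ifP => _; ring.
- by apply: funext => w; ring.
- by rewrite IHx IHy; apply: funext => w; ring.
Qed.

Lemma hdual_termZ x a f :
  hdual_term x (fun w => a * f w) = fun w => a * hdual_term x f w.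
Proof.
have := hdual_term_lin x a 0 f f => E.
rewrite (_ : (fun w => a * f w) = fun w => a * f w + 0 * f w).
  by rewrite E; apply: funext => w; ring.
by apply: funext => w; ring.
Qed.

Lemma hdual_termD x f f' :
  hdual_term x (fun w => f w + f' w)
    = fun w => hdual_term x f w + hdual_term x f' w.
Proof.
have := hdual_term_lin x 1 1 f f' => E.
rewrite (_ : (fun w => f w + f' w) = fun w => 1 * f w + 1 * f' w).
  by rewrite E; apply: funext => w; ring.
by apply: funext => w; ring.
Qed.

Lemma hdual_rdual j x f : hdual_term x (rdual j f) = rdual j (hdual_term x f).
Proof.
elim: x f => [i|a|x IHx y IHy|x IHx y IHy] f /=.
- exact: ldual_rdual.
- by apply: funext => w; rewrite /rdual; case: ifP => _; ring.
- by rewrite IHx IHy; apply: funext => w; rewrite /rdual; case: ifP => _; ring.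
- by rewrite IHx IHy.
Qed.

(* Evaluation at w factors through an operator that commutes with the dual
   action, followed by evaluation at 1. *)
Lemma eval_commutant w : exists A : (W -> R) -> (W -> R),
  (forall x f, hdual_term x (A f) = A (hdual_term x f)) /\
  forall f, A f 1%g = f w.
Proof.
have [u [uR uw]] := cox_length_ex w; rewrite -{w}uw in uR *.
elim/last_ind: u uR => [|u j IHu] uR.
  by exists id; split=> // f; rewrite cox_word_nil.
have ujE : cw (rcons u j) = (cw u * s j)%g by rewrite -cats1 cox_wordD.
have := cox_length_genr j (cw u); have := cox_length_le m u.
rewrite size_rcons ujE in uR; rewrite -uR => le_u sz_u.
have [|A [Acomm A1]] := IHu; first by lia.
exists (A \o rdual j); split=> [x f|f] /=.
  by rewrite Acomm hdual_rdual.
by rewrite A1 /rdual ujE -uR ifT //; lia.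
Qed.

Lemma hdual_word u f : size u = l (cw u) ->
  hdual_term (hterm_word R u) f 1%g = f (cw u).
Proof.
elim: u f => [|i u IHu] f /= uR; first by rewrite mul1r.
have := cox_length_genl i (cw u); have := cox_length_le m u.
rewrite cox_word_cons in uR *; rewrite -uR => le_u sz_u.
by rewrite IHu; [rewrite /ldual -uR ifT //; lia | lia].
Qed.

(** Commutation reduces the identity to its value at 1, where a reduced word evaluates f at its
    group element; both alternating words are reduced and represent the same element. *)
Lemma hdual_braid i j f :
  hdual_term (hterm_word R (alt_word i j (m i j))) f
    = hdual_term (hterm_word R (alt_word j i (m i j))) f.
Proof.
have [->//|/eqP ij] := eqVneq i j.
apply: funext => w; have [A [Acomm A1]] := eval_commutant w.
have red_ij : size (alt_word i j (m i j)) = l (cw (alt_word i j (m i j))).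
  by rewrite size_alt_word alt_word_length.
have red_ji : size (alt_word j i (m i j)) = l (cw (alt_word j i (m i j))).
  by rewrite -cox_word_braid -red_ij !size_alt_word.
by rewrite -!A1 -!Acomm (hdual_word _ red_ij) (hdual_word _ red_ji) cox_word_braid.
Qed.

Lemma hdual_term_congr x y : hcongr q m x y -> hdual_term x =1 hdual_term y.
Proof.
elim=> //=.
- move=> i f; apply: funext => w; rewrite /ldual cox_genK.
  have := cox_length_descent i w.
  case: (ltnP (l w)) => /= h; case: (ltnP _ (l w)) => //= h' _; try ring.
- by move=> i j f; rewrite hdual_braid.
- by move=> a b f; apply: funext => w; ring.
- by move=> a b f; apply: funext => w; ring.
- by move=> a x0 f; rewrite hdual_termZ.
- by move=> x0 y0 z0 f; apply: funext => w; ring.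
- by move=> x0 y0 f; apply: funext => w; ring.
- by move=> x0 f; apply: funext => w; ring.
- by move=> x0 f; rewrite -[RHS]/(hdual_term x0 f); congr hdual_term;
     apply: funext => w; ring.
- by move=> x0 f; rewrite hdual_termZ; apply: funext => w; rewrite !mul0r.
- by move=> x0 y0 z0 f; rewrite hdual_termD.
- by move=> x0 x' y0 y' _ IHx _ IHy f; rewrite IHx IHy.
- by move=> x0 x' y0 y' _ IHx _ IHy f; rewrite IHx IHy.
- by move=> x0 y0 _ IH f; rewrite IH.
- by move=> x0 y0 z0 _ IH1 _ IH2 f; rewrite IH1 IH2.
Qed.

Definition hdual (x : H) (f : W -> R) : W -> R := hdual_term (repr x) f.

Lemma hdual_class x : hdual (hclass q m x) = hdual_term x.
Proof.
by apply: funext => f; apply: hdual_term_congr; apply/hclassP/hclass_repr.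
Qed.

Lemma hdualM x y f : hdual (x * y) f = hdual y (hdual x f).
Proof.
by rewrite -[x]hclass_repr -[y]hclass_repr -hclass_mul !hdual_class.
Qed.

Lemma hdualD x y f w : hdual (x + y) f w = hdual x f w + hdual y f w.
Proof.
by rewrite -[x]hclass_repr -[y]hclass_repr -hclass_add !hdual_class.
Qed.

Lemma hdualZ a x f w : hdual (a *: x) f w = a * hdual x f w.
Proof.
rewrite -[x]mul1r scalerAl -hclass_scal hdualM hdual_class mul1r /=.
by rewrite /hdual hdual_termZ.
Qed.

Lemma hdual_gen i f : hdual (g i) f = ldual i f.
Proof. by rewrite hdual_class. Qed.

Lemma hdual_std w f : hdual (T w) f 1%g = f w.
Proof.
have [u [szu uw]] := cox_length_ex w; rewrite -uw in szu *.
by rewrite hecke_std_word // hecke_wordE hdual_class hdual_word.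
Qed.

(** Pairing with the indicator of w: by [hdual_std] this extracts the coefficient of T_w, so the T_w
    are linearly independent. *)
Definition hcoef (w : W) (x : H) : R := hdual x (fun y => (y == w)%:R) 1%g.

Lemma hcoef_is_linear w : linear_for *%R (hcoef w).
Proof. by move=> a x y; rewrite /hcoef hdualD hdualZ. Qed.

HB.instance Definition _ w :=
  GRing.isLinear.Build R H R *%R (hcoef w) (hcoef_is_linear w).

Lemma hcoefD w x y : hcoef w (x + y) = hcoef w x + hcoef w y.
Proof. exact: linearD. Qed.

Lemma hcoefB w x y : hcoef w (x - y) = hcoef w x - hcoef w y.
Proof. exact: linearB. Qed.

Lemma hcoefZ w a x : hcoef w (a *: x) = a * hcoef w x.
Proof. exact: linearZ. Qed.

Lemma hcoef_sum w (J : Type) (r : seq J) (P : pred J) (F : J -> H) :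
  hcoef w (\sum_(k <- r | P k) F k) = \sum_(k <- r | P k) hcoef w (F k).
Proof. exact: linear_sum. Qed.

Lemma hcoef_std w y : hcoef w (T y) = (y == w)%:R.
Proof. exact: hdual_std. Qed.

Lemma hcoef_gen_up i x w : (l w < l (s i * w)%g)%N ->
  hcoef w (g i * x) = q * hcoef (s i * w)%g x.
Proof.
move=> lt_w; rewrite /hcoef hdualM hdual_gen.
have -> : ldual i (fun y => (y == w)%:R) =
    fun y => q * (y == s i * w)%g%:R.
  apply: funext => y; rewrite /ldual.
  have -> : (y == s i * w)%g = (s i * y == w)%g.
    by rewrite -{1}(cox_genK i y) (inj_eq (mulgI _)).
  case: ltnP => lt_y.
    have [yw|] := eqVneq (s i * y)%g w; last by rewrite mulr0.
    by rewrite -yw cox_genK in lt_w; lia.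
  have [yw|] := eqVneq y w; first by rewrite yw in lt_y; lia.
  by rewrite mulr0 add0r.
by rewrite /hdual hdual_termZ.
Qed.

Lemma hcoef_gen_down i x w : (l (s i * w)%g < l w)%N ->
  hcoef w (g i * x) = hcoef (s i * w)%g x + (q - 1) * hcoef w x.
Proof.
move=> lt_w; rewrite /hcoef hdualM hdual_gen.
have -> : ldual i (fun y => (y == w)%:R) =
    fun y => (y == s i * w)%g%:R + (q - 1) * (y == w)%:R.
  apply: funext => y; rewrite /ldual.
  have -> : (y == s i * w)%g = (s i * y == w)%g.
    by rewrite -{1}(cox_genK i y) (inj_eq (mulgI _)).
  case: ltnP => lt_y.
    have [yw|] := eqVneq y w; first by rewrite yw in lt_y; lia.
    by rewrite mulr0 addr0.
  have [yw|] := eqVneq (s i * y)%g w; last by rewrite mulr0 addr0 add0r.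
  by rewrite -yw cox_genK in lt_w; lia.
by rewrite /hdual hdual_termD hdual_termZ.
Qed.

(** * Spanning and expansion in the standard basis *)

Definition std_spanned (x : H) : Prop :=
  exists r : seq (R * W), x = \sum_(p <- r) p.1 *: T p.2.

Lemma std_spannedD x y : std_spanned x -> std_spanned y -> std_spanned (x + y).
Proof. by move=> [r ->] [r' ->]; exists (r ++ r'); rewrite big_cat. Qed.

Lemma std_spannedZ a x : std_spanned x -> std_spanned (a *: x).
Proof.
move=> [r ->]; exists [seq (a * p.1, p.2) | p <- r].
by rewrite big_map scaler_sumr; apply: eq_bigr => p _; rewrite scalerA.
Qed.

Lemma std_spanned_std w : std_spanned (T w).
Proof. by exists [:: (1, w)]; rewrite big_seq1 scale1r. Qed.

(** Taken at y = 1, this shows that the T_w span the whole algebra. *)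
Lemma std_spanned_mul x y : std_spanned y -> std_spanned (x * y).
Proof.
rewrite -[x]hclass_repr; elim: (repr x) y => {x} [i|a|x IHx z IHz|x IHx z IHz] y ySp.
- case: ySp => r ->; rewrite mulr_sumr.
  elim: r => [|p r IHr]; first by exists [::]; rewrite !big_nil.
  rewrite big_cons; apply: std_spannedD IHr; rewrite -scalerAr.
  apply: std_spannedZ; case: (ltnP (l p.2) (l (s i * p.2)%g)) => [lt_w|le_w].
    by rewrite hecke_gen_std_up //; apply: std_spanned_std.
  rewrite hecke_gen_std_down; last by have := cox_length_genl i p.2; lia.
  by apply: std_spannedD; apply: std_spannedZ; apply: std_spanned_std.
- by rewrite hclass_scal -scalerAl mul1r; apply: std_spannedZ.
- by rewrite hclass_add mulrDl; apply: std_spannedD; [apply: IHx|apply: IHz].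
- by rewrite hclass_mul -mulrA; apply: IHx; apply: IHz.
Qed.

Lemma hecke_std_expansion x :
  exists r : seq W, uniq r /\ x = \sum_(w <- r) hcoef w x *: T w.
Proof.
have [r xE] : std_spanned x.
  rewrite -[x]mulr1; apply: std_spanned_mul; rewrite -hecke_std1.
  exact: std_spanned_std.
exists (undup [seq p.2 | p <- r]); split; first exact: undup_uniq.
rewrite {1}xE; under [RHS]eq_bigr => w _.
  rewrite {1}xE linear_sum scaler_suml.
  under eq_bigr => p _ do rewrite linearZ /= hcoef_std.
  over.
rewrite exchange_big /= [LHS]big_seq_cond [RHS]big_seq_cond.
apply: eq_bigr => p /andP[pr _].
rewrite (bigD1_seq p.2) ?undup_uniq ?mem_undup ?map_f //= eqxx mulr1 big1 ?addr0 //.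
by move=> w /negPf; rewrite eq_sym => ->; rewrite mulr0 scale0r.
Qed.

Lemma hcoef_notin (x : H) (r : seq W) w :
  x = \sum_(y <- r) hcoef y x *: T y -> w \notin r -> hcoef w x = 0.
Proof.
move=> xE wr; rewrite xE hcoef_sum big_seq big1 // => y yr.
rewrite hcoefZ hcoef_std; case: eqP => [yw|_]; last by rewrite mulr0.
by rewrite -yw yr in wr.
Qed.

Lemma hcoef_bounded x : exists n, forall w, (n <= l w)%N -> hcoef w x = 0.
Proof.
have [r [_ xE]] := hecke_std_expansion x.
exists (\max_(w <- r) l w).+1 => w lt_w; apply: hcoef_notin xE _.
by apply: contraL lt_w => wr; rewrite -leqNgt; apply: leq_bigmax_seq.
Qed.

Lemma hcoef_inj x y : (forall w, hcoef w x = hcoef w y) -> x = y.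
Proof.
move=> xy; apply/eqP; rewrite -subr_eq0; apply/eqP.
have [r [_ ->]] := hecke_std_expansion (x - y).
by apply: big1 => w _; rewrite linearB /= xy subrr scale0r.
Qed.

End HeckeBasis.

(** * Laurent polynomials *)

Section LaurentPolynomials.

Variable kappa : fieldType.

Local Notation Lambda := (laurent kappa).
Local Notation v := (lv kappa).
Local Notation lp := (@laurent_poly kappa).

Lemma laurent_poly_inj : injective lp.
Proof.
move=> p r /(congr1 (@laurent_val kappa)) /= /eqP.
by rewrite tofrac_eq => /eqP.
Qed.

Lemma laurent_poly_zmod_morphism : zmod_morphism lp.
Proof. by move=> p r; apply: laurent_val_inj; rewrite rmorphB /= tofracB. Qed.

Lemma laurent_poly_monoid_morphism : monoid_morphism lp.
Proof.
split=> [|p r]; apply: laurent_val_inj; first by rewrite rmorph1 /= tofrac1.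
by rewrite rmorphM /= tofracM.
Qed.

HB.instance Definition _ := GRing.isZmodMorphism.Build
  {poly kappa} Lambda lp laurent_poly_zmod_morphism.
HB.instance Definition _ := GRing.isMonoidMorphism.Build
  {poly kappa} Lambda lp laurent_poly_monoid_morphism.

Lemma lv_unit : v \is a GRing.unit.
Proof.
have XV : (tofrac ('X : {poly kappa}))^-1 \in @is_laurent kappa.
  by apply/asboolP; exists 1, 1%N; rewrite tofrac1 expr1 mul1r.
apply/unitrPr; exists (Laurent XV); apply: laurent_val_inj.
by rewrite rmorphM rmorph1 /= divff ?fracX_neq0.
Qed.

Lemma lq_unit : lq kappa \is a GRing.unit.
Proof. by rewrite unitrX ?lv_unit. Qed.

Lemma lq_expr n : lq kappa ^+ n = v ^+ n * v ^+ n.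
Proof. by rewrite /lq expr2 exprMn. Qed.

(** The exponent count for Kazhdan-Lusztig coefficients: n is l(y), k the degree of a monomial of
    P_{y,w}, and the middle exponent is l(w). *)
Lemma lv_lq_cancel n k d :
  v ^+ n * v ^+ (n + k.*2 + d.+1) * (lq kappa ^- n * (lq kappa)^-1 ^+ k)
    = v ^+ d * v.
Proof.
set u := _ * (lq kappa)^-1 ^+ k.
have uE : u * (lq kappa ^+ n * lq kappa ^+ k) = 1.
  by rewrite /u exprVn mulrACA !mulVr ?mulr1 // unitrX ?lq_unit.
rewrite -[RHS]mulr1 -uE !lq_expr !exprD exprS -addnn exprD; ring.
Qed.

(** With a and b the coefficients of c at sz and z, and l(z) = n + 1, the left side is the
    normalised coefficient of v^-1 (T_s + 1) c at z. *)
Lemma lv_shift n (a b : Lambda) :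
  v ^+ n.+1 * (v^-1 * (a + (lq kappa - 1) * b + b))
    = v ^+ n * a + v * (v ^+ n.+1 * b).
Proof. by rewrite exprSr -mulrA mulVKr ?lv_unit // /lq; ring. Qed.

Lemma pevalE (p : {poly kappa}) x :
  peval p x = \sum_(i < size p) lconst p`_i * x ^+ i.
Proof. by rewrite /peval /map_poly horner_poly. Qed.

Lemma peval_lv (p : {poly kappa}) : peval p v = lp p.
Proof.
rewrite pevalE -[in RHS](coefK p) poly_def rmorph_sum; apply: eq_bigr => i _.
by rewrite -mul_polyC rmorphM rmorphXn.
Qed.

Lemma laurentP (a : Lambda) : exists p n, a = lp p * v ^- n.
Proof.
have /asboolP[p [n aE]] := laurent_valP a; exists p, n.
have vn : v ^+ n \is a GRing.unit by rewrite unitrX ?lv_unit.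
apply: (mulIr vn); rewrite mulrVK //; apply: laurent_val_inj.
by rewrite rmorphM rmorphXn /= aE mulfVK // expf_neq0 ?fracX_neq0.
Qed.

Definition in_vpoly (a : Lambda) : Prop := exists p, a = lp p * v.

Lemma in_vpoly0 : in_vpoly 0.
Proof. by exists 0; rewrite rmorph0 mul0r. Qed.

Lemma in_vpoly_lv : in_vpoly v.
Proof. by exists 1; rewrite rmorph1 mul1r. Qed.

Lemma in_vpolyD a b : in_vpoly a -> in_vpoly b -> in_vpoly (a + b).
Proof. by move=> [p ->] [r ->]; exists (p + r); rewrite rmorphD mulrDl. Qed.

Lemma in_vpolyM p a : in_vpoly a -> in_vpoly (lp p * a).
Proof. by move=> [r ->]; exists (p * r); rewrite rmorphM mulrA. Qed.

Lemma in_vpoly_fixed (p : {poly kappa}) :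
  peval ('X * p) v^-1 = lp ('X * p) -> 'X * p = 0.
Proof.
set r := 'X * p; set N := size r => rE.
(* This is v^N r(v^-1), of degree at most N, whereas r v^N carries every nonconstant coefficient of
   r in degree above N. *)
pose r' := \sum_(i < N) r`_i *: 'X^(N - i).
have vi n : v ^+ n \is a GRing.unit by rewrite unitrX ?lv_unit.
have r'E : r * 'X^N = r'.
  apply: laurent_poly_inj; rewrite rmorphM /= -rE pevalE mulr_suml /r' rmorph_sum /=.
  apply: eq_bigr => i _; rewrite rmorphXn -mul_polyC rmorphM rmorphXn -mulrA.
  congr (_ * _); rewrite /= -/v; case: i => i /= /ltnW le_iN.
  by rewrite -{1}(subnKC (le_iN : (i <= N)%N)) exprD mulrA exprVn mulVr ?mul1r.
apply/polyP => -[|k]; rewrite coef0; first by rewrite /r coefXM.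
have := congr1 (fun t : {poly kappa} => t`_(k.+1 + N)) r'E.
rewrite /= coefMXn ltnNge leq_addl addnK /= => ->.
rewrite /r' coef_sum big1 // => i _; rewrite coefZ coefXn.
by rewrite (_ : (_ == _) = false) ?mulr0 //; apply/eqP; lia.
Qed.

End LaurentPolynomials.

(** * Kazhdan-Lusztig elements *)

Section KazhdanLusztigBasis.

Variables (kappa : fieldType) (I : choiceType) (m : coxeter_matrix I).

Local Notation Lambda := (laurent kappa).
Local Notation v := (lv kappa).
Local Notation q := (lq kappa).
Local Notation W := (coxeter_group m).
Local Notation H := (hecke (lq kappa) m).
Local Notation T := (@hecke_std Lambda q I m).
Local Notation l := (@cox_length I m).
Local Notation s := (cox_gen m).
Local Notation g := (hecke_gen q m).
Local Notation lp := (@laurent_poly kappa).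

Lemma hcoef_scal (a : Lambda) : hcoef (1%g : W) (a%:A : H) = a.
Proof. by rewrite hcoefZ -hecke_std1 hcoef_std eqxx mulr1. Qed.

Lemma scal_mul (a b : Lambda) : a%:A * b%:A = (a * b)%:A :> H.
Proof. by rewrite -scalerAl mul1r scalerA. Qed.

(** * The bar involution and its triangularity *)

Section BarInvolution.

Variables (bar : {rmorphism H -> H}) (hbar : is_bar_involution bar).

(** Reading v -> v^-1 off [bar] through the coefficient of T_1 lets it inherit the ring morphism
    laws. *)
Definition lbar (a : Lambda) : Lambda := hcoef (1%g : W) (bar a%:A).

Lemma lbar_repr (p : {poly kappa}) n :
  lbar (peval p v * v ^- n) = peval p v^-1 * v^-1 ^- n.
Proof. by rewrite /lbar (bar_scalar hbar) hcoef_scal. Qed.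

Lemma bar_scal a : bar a%:A = (lbar a)%:A.
Proof.
have [p [n ->]] := laurentP a.
by rewrite -peval_lv lbar_repr (bar_scalar hbar).
Qed.

Lemma barZ a x : bar (a *: x) = lbar a *: bar x.
Proof. by rewrite -[x]mul1r scalerAl rmorphM bar_scal -scalerAl !mul1r. Qed.

Lemma lbar_zmod_morphism : zmod_morphism lbar.
Proof. by move=> a b; rewrite /lbar scalerBl rmorphB linearB. Qed.

HB.instance Definition _ := GRing.isZmodMorphism.Build
  Lambda Lambda lbar lbar_zmod_morphism.

Lemma lbar_monoid_morphism : monoid_morphism lbar.
Proof.
split=> [|a b]; first by rewrite /lbar scale1r rmorph1 -[1]scale1r hcoef_scal.
by rewrite /lbar -{1}scalerA barZ hcoefZ.
Qed.

HB.instance Definition _ := GRing.isMonoidMorphism.Build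
  Lambda Lambda lbar lbar_monoid_morphism.

Lemma lbar_lp (p : {poly kappa}) : lbar (lp p) = peval p v^-1.
Proof. by have := lbar_repr p 0; rewrite !expr0 !divr1 peval_lv. Qed.

Lemma lbar_lv : lbar v = v^-1.
Proof.
rewrite lbar_lp pevalE size_polyX !big_ord_recl big_ord0 !coefX /=.
by rewrite /lconst rmorph0 rmorph1 mul0r add0r mul1r addr0.
Qed.

Lemma in_vpoly_lbar a : in_vpoly a -> lbar a = a -> a = 0.
Proof.
case=> p; rewrite mulrC -[v]/(lp 'X) -rmorphM => ->; rewrite lbar_lp.
by move/in_vpoly_fixed => ->; rewrite rmorph0.
Qed.

(** By the quadratic relation the right side is a right inverse of T_s, and [bar (g i)] is a left
    inverse. *)
Lemma bar_gen i : bar (g i) = q^-1 *: g i + (q^-1 - 1)%:A.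
Proof.
have [+ _] := bar_std hbar (s i); rewrite cox_genV hecke_std_gen => bar_g.
set x := _ + _; have gx : g i * x = 1.
  rewrite /x mulrDr -!scalerAr mulr1 hecke_gen_sqr scalerDr !scalerA.
  rewrite mulrBr mulr1 mulVr ?lq_unit // scale1r addrAC -scalerDl.
  by rewrite addrA subrK subrr scale0r add0r.
by rewrite -[LHS]mulr1 -gx mulrA bar_g mul1r.
Qed.

(** Peeling off a generator multiplies by q^-1 T_s plus a scalar; the scalar part cannot reach the
    new length, so each letter contributes q^-1 to the top coefficient. *)
Lemma hcoef_bar_std w x : (l w <= l x)%N ->
  hcoef x (bar (T w)) = (w == x)%:R * v ^- (l w).*2.
Proof.
elim/cox_ind: w x => [|i w lt_w IHw] x le_x.
  rewrite hecke_std1 rmorph1 -hecke_std1 hcoef_std.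
  by rewrite cox_length1 divr1.
have lw := cox_length_genl i w; have lx := cox_length_genl i x.
rewrite -hecke_gen_std_up // rmorphM bar_gen mulrDl -!scalerAl mul1r.
have wx : (w == x) = false.
  by apply/eqP=> wx; rewrite wx in lt_w le_x; lia.
rewrite hcoefD 2!hcoefZ (IHw x) ?wx; last by lia.
rewrite mul0r mulr0 addr0; have [lt_x|le_sx] := ltnP (l x) (l (s i * x)%g).
  have sw_x : (s i * w == x)%g = false.
    by apply/eqP=> swx; rewrite -swx cox_genK in lt_x; lia.
  have w_sx : (w == s i * x)%g = false.
    by apply/eqP=> wsx; rewrite -wsx in lx lt_x le_x; lia.
  rewrite hcoef_gen_up // IHw; last by lia.
  by rewrite w_sx sw_x !mul0r !mulr0.
have lt_sx : (l (s i * x)%g < l x)%N by lia.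
rewrite hcoef_gen_down // !IHw; try lia.
rewrite wx mul0r mulr0 addr0.
have -> : (s i * w == x)%g = (w == s i * x)%g.
  by rewrite -{2}(cox_genK i w) (inj_eq (mulgI _)).
have -> : l (s i * w)%g = (l w).+1 by lia.
rewrite doubleS -addn2 addnC exprD [in RHS]invrM ?unitrX ?lv_unit //.
by rewrite mulrCA [q^-1 * _]mulrC.
Qed.

(** By triangularity, among the T_w with l(w) <= l(z) only T_z contributes at z after applying
    [bar]. *)
Lemma hcoef_bar_top x z : (forall y, (l z < l y)%N -> hcoef y x = 0) ->
  hcoef z (bar x) = lbar (hcoef z x) * v ^- (l z).*2.
Proof.
move=> x_top; have [r [_ xE]] := hecke_std_expansion x.
rewrite {1 2}xE !raddf_sum mulr_suml /=; apply: eq_bigr => w _.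
rewrite barZ !hcoefZ hcoef_std.
have [le_w|lt_w] := leqP (l w) (l z); last first.
  by rewrite x_top // rmorph0 !mul0r rmorph0 mul0r.
rewrite hcoef_bar_std //; have [->|_] := eqVneq w z; first by rewrite mul1r mulr1.
by rewrite mul0r !mulr0 rmorph0 mul0r.
Qed.

(** * Coefficients of a Kazhdan-Lusztig element *)

Section KLElement.

Variables (w : W) (c : H) (cKL : is_KL_element bar w c).

Lemma KL_hcoef : exists P : W -> {poly kappa},
  [/\ P w = 1,
      forall y, bruhat_lt y w -> ((size (P y)).-1.*2 <= l w - l y - 1)%N,
      forall z, bruhat_le z w ->
        hcoef z c = (-1) ^+ l z * (-1) ^+ l w * v ^+ l w * q ^- l z
                      * peval (P z) q^-1 &
      forall z, ~ bruhat_le z w -> hcoef z c = 0].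
Proof.
have [_ [P [Pw Pdeg ->]]] := cKL; exists P.
have fin := bruhat_interval_finite w.
split=> // z zw; rewrite fsbig_finite //= hcoef_sum.
  have z_in : z \in fset_set [set y | bruhat_le y w].
    by rewrite in_fset_set //; exact: mem_set.
  rewrite (bigD1_seq z) ?fset_uniq //= hcoefZ hcoef_std eqxx mulr1.
  rewrite big1 ?addr0 // => y /negPf yz.
  by rewrite hcoefZ hcoef_std yz mulr0.
rewrite big_seq big1 // => y; rewrite in_fset_set // => /set_mem /= yw.
rewrite hcoefZ hcoef_std; case: eqP => [yz|]; last by rewrite mulr0.
by rewrite yz in yw.
Qed.

Lemma KL_hcoef_lead : hcoef w c = v ^- l w.
Proof.
have [P [Pw _ cE _]] := KL_hcoef; rewrite cE; last exact: rt_refl.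
have vl : v ^+ l w \is a GRing.unit by rewrite unitrX ?lv_unit.
rewrite Pw pevalE size_poly1 big_ord1 coefC eqxx mulr1 /lconst rmorph1.
rewrite -expr2 sqrr_sign mul1r mulr1 lq_expr invrM // mulrA.
by rewrite mulrV // mul1r.
Qed.

Lemma KL_hcoef_ge y : y != w -> (l w <= l y)%N -> hcoef y c = 0.
Proof.
move=> yw le_w; have [P [_ _ _ c0]] := KL_hcoef; apply: c0.
case/bruhat_le_length => [/eqP|]; first by rewrite (negPf yw).
by rewrite ltnNge le_w.
Qed.

Lemma KL_hcoef_vpoly y : y != w -> in_vpoly (v ^+ l y * hcoef y c).
Proof.
move=> yw; have [P [_ Pdeg cE c0]] := KL_hcoef.
have [le_y|/c0 ->] := pselect (bruhat_le y w); last first.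
  by rewrite mulr0; exact: in_vpoly0.
have lt_y : bruhat_lt y w by split=> //; apply/eqP.
have := Pdeg _ lt_y; have := bruhat_lt_length lt_y; rewrite cE // pevalE => lt_l dP.
have signE n : (-1) ^+ n = lp ((-1) ^+ n) :> Lambda by rewrite rmorphXn rmorphN1.
have mulA (a b e f x y' : Lambda) :
    x * (a * b * e * f * y') = a * (b * (x * e * f * y')).
  by ring.
rewrite mulA !signE; do 2!apply: in_vpolyM; rewrite mulr_sumr.
elim/big_ind: _ => [||k _]; [exact: in_vpoly0|exact: in_vpolyD|].
rewrite mulrCA -(mulrA (v ^+ l y * v ^+ l w)); apply: in_vpolyM.
have lt_k := ltn_ord k.
(* The degree bound makes l(w) - l(y) - 2k positive; splitting off 1 leaves the factor v that
   [in_vpoly] requires. *)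
have -> : l w = (l y + k.*2 + (l w - l y - k.*2).-1.+1)%N by lia.
rewrite lv_lq_cancel; exists ('X ^+ (l w - l y - k.*2).-1).
by rewrite rmorphXn.
Qed.

End KLElement.

(* The normalised leading coefficients of [x] are bar-invariant, so they vanish
   as soon as they lie in v kappa[v]. *)
Lemma bar_invariant_eq0 x :
  bar x = x ->
  (forall z, (forall y, (l z < l y)%N -> hcoef y x = 0) ->
     hcoef z x = 0 \/ in_vpoly (v ^+ l z * hcoef z x)) ->
  x = 0.
Proof.
move=> bar_x x_lead; have [N x_N] := hcoef_bounded x.
(* Descending induction on length: n bounds the distance of l(z) below N. *)
suff x0 n z : (N <= l z + n)%N -> hcoef z x = 0.
  by apply: hcoef_inj => z; rewrite linear0 (x0 N) // leq_addl.
elim: n z => [|n IHn] z le_N; first by apply: x_N; rewrite -(addn0 (l z)).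
have z_top y : (l z < l y)%N -> hcoef y x = 0 by move=> lt_y; apply: IHn; lia.
have [//|z_vpoly] := x_lead z z_top.
have vl : v ^+ l z \is a GRing.unit by rewrite unitrX ?lv_unit.
apply: (mulrI vl); rewrite mulr0; apply: (in_vpoly_lbar z_vpoly).
have hE := hcoef_bar_top z_top; rewrite bar_x in hE.
rewrite rmorphM rmorphXn /= lbar_lv [in RHS]hE exprVn -addnn exprD invrM //.
by rewrite [RHS]mulrCA mulVKr // mulrC.
Qed.

Lemma KL_eigen i w c : is_KL_element bar w c -> (l (s i * w)%g < l w)%N ->
  g i * c = - c.
Proof.
move=> cKL lt_w; have [bar_c _] := cKL.
set x := v^-1 *: ((g i + 1) * c).
suff x0 : x = 0.
  have : v *: x = 0 by rewrite x0 scaler0.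
  rewrite scalerA mulrV ?lv_unit // scale1r mulrDl mul1r => /eqP.
  by rewrite addr_eq0 => /eqP.
(* The image of T_s + 1 lies in the q-eigenspace, where coefficients at z and sz agree. *)
have up z : (l z < l (s i * z)%g)%N -> hcoef z x = hcoef (s i * z)%g x.
  move=> lt_z; rewrite !hcoefZ mulrDl mul1r !hcoefD hcoef_gen_up //.
  by rewrite hcoef_gen_down ?cox_genK //; ring.
apply: bar_invariant_eq0 => [|z z_top].
  (* Here bar(T_s + 1) = q^-1 (T_s + 1), and the scalar v^-1 becomes v, with v q^-1 = v^-1. *)
  rewrite /x barZ rmorphM rmorphD rmorph1 bar_c bar_gen.
  rewrite rmorphV ?lv_unit //= lbar_lv invrK scalerBl scale1r -addrA subrK.
  rewrite -scalerDr -scalerAl scalerA.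
  by congr (_ *: _); rewrite /lq expr2 invrM ?lv_unit // mulrA mulrV ?lv_unit ?mul1r.
have := cox_length_genl i z; have [lt_z lz|le_z lz] := ltnP (l z) (l (s i * z)%g).
  by left; rewrite up // z_top.
have lt_sz : (l (s i * z)%g < l z)%N by lia.
(* Since s lowers w but raises sz, the coefficient at sz is not the leading one and the degree bound
   applies to it. *)
have sz_w : (s i * z)%g != w.
  by apply/eqP=> szw; rewrite -szw cox_genK in lt_w; lia.
right; rewrite hcoefZ mulrDl mul1r hcoefD hcoef_gen_down //.
have -> : l z = (l (s i * z)%g).+1 by lia.
rewrite lv_shift.
apply: in_vpolyD; first exact: (KL_hcoef_vpoly cKL).
have <- : l z = (l (s i * z)%g).+1 by lia.
(* At z = w the normalised coefficient is only 1; the extra factor v from [lv_shift] brings it into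
   v kappa[v]. *)
have [->|zw] := eqVneq z w.
  rewrite (KL_hcoef_lead cKL) mulrV ?mulr1; first exact: in_vpoly_lv.
  by rewrite unitrX ?lv_unit.
by apply: (in_vpolyM 'X); apply: (KL_hcoef_vpoly cKL).
Qed.

(** * The eigenspace of eigenvalue -1 *)

Section Span.

Variables (C : W -> H) (hC : forall w, is_KL_element bar w (C w)) (j : I).

Local Notation descents := [set w | bruhat_lt (s j * w)%g w].

Lemma eigen_hcoef x w : g j * x = - x -> (l w < l (s j * w)%g)%N ->
  hcoef w x = - q * hcoef (s j * w)%g x.
Proof.
move=> gx lt_w; have := congr1 (hcoef w) gx.
by rewrite hcoef_gen_up // linearN mulNr => ->; rewrite opprK.
Qed.

Lemma eigen_span_lt n x : g j * x = - x ->
  (forall y, (n <= l y)%N -> hcoef y x = 0) ->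
  linear_span [set C w | w in descents] x.
Proof.
elim: n x => [|n IHn] x gx x_n.
  exists [::]; split=> //; rewrite big_nil.
  by apply: hcoef_inj => y; rewrite linear0 x_n.
have [r [r_uniq xE]] := hecke_std_expansion x.
pose r' := [seq w <- r | (l w == n) && (l (s j * w)%g < l w)%N].
(* The factor v^l(w) cancels the leading coefficient v^-l(w) of C_w, so subtraction kills the
   coefficients at length n. *)
pose t := [seq (hcoef w x * v ^+ l w, C w) | w <- r'].
have tP p : p \in t -> [set C w | w in descents] p.2.
  case/mapP=> w; rewrite mem_filter => /andP[/andP[_ lt_w] _] -> /=.
  by exists w => //; apply/bruhat_lt_genl.
pose x' := x - \sum_(p <- t) p.1 *: p.2.
have [|y le_y|t' [t'P x'E]] := IHn x'.
- rewrite mulrBr gx opprB addrC; congr (_ + _).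
  rewrite mulr_sumr -sumrN big_seq [RHS]big_seq; apply: eq_bigr => p /tP[w dw <-].
  by rewrite -scalerAr (KL_eigen (hC w) ((bruhat_lt_genl j w).1 dw)) scalerN opprK.
- rewrite /x' hcoefB hcoef_sum big_map.
  have [yr'|yr'] := boolP (y \in r').
    rewrite (bigD1_seq y) ?filter_uniq //= hcoefZ (KL_hcoef_lead (hC y)).
    rewrite mulrK ?unitrX ?lv_unit // big_seq_cond big1 ?addr0 ?subrr // => w.
    rewrite mem_filter => /andP[/andP[/andP[/eqP lw _] _] wy].
    by rewrite hcoefZ (KL_hcoef_ge (hC w)) ?mulr0 ?lw // eq_sym.
  rewrite big_seq big1 ?subr0 => [|w wr'].
    move: le_y; rewrite leq_eqVlt => /orP[/eqP ly|]; last exact: x_n.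
    (* If s raises y, the coefficient at y is -q times one of length n + 1, hence 0; otherwise y
       could be missing from r' only by being missing from r. *)
    have [lt_y|le_sy] := ltnP (l y) (l (s j * y)%g).
      by rewrite eigen_hcoef // x_n ?mulr0 // ly.
    have yr : y \notin r.
      apply: contra yr' => yr; rewrite mem_filter yr ly eqxx andbT /=.
      by have := cox_length_genl j y; lia.
    exact: hcoef_notin xE yr.
  have wy : y != w by apply: contraNneq yr' => ->.
  move: wr'; rewrite mem_filter => /andP[/andP[/eqP lw _] _].
  by rewrite hcoefZ (KL_hcoef_ge (hC w)) ?mulr0 ?lw.
exists (t' ++ t); split=> [p|].
  by rewrite mem_cat => /orP[/t'P|/tP].
by rewrite big_cat /= -x'E subrK.
Qed.

Lemma KL_eigenspace :
  left_eigenspace (g j) (- 1) = linear_span [set C w | w in descents].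
Proof.
apply/seteqP; split=> x /=.
  rewrite /left_eigenspace /= scaleN1r => gx; have [n x_n] := hcoef_bounded x.
  exact: eigen_span_lt x_n.
case=> r [rP ->]; rewrite /left_eigenspace /= scaleN1r mulr_sumr -sumrN.
rewrite big_seq [RHS]big_seq; apply: eq_bigr => p /rP[w dw <-].
by rewrite -scalerAr (KL_eigen (hC w) ((bruhat_lt_genl j w).1 dw)) scalerN.
Qed.

End Span.

End BarInvolution.

(** * The involution delta and the eigenspace of eigenvalue q *)

Section Delta.

Variables (delta : {rmorphism H -> H}) (hdelta : is_delta delta).

Lemma delta_lvV : delta (v^-1)%:A = (- v)%:A.
Proof.
have vv : (- v^-1)%:A * (- v)%:A = 1 :> H.
  by rewrite scal_mul mulrNN mulVr ?lv_unit ?scale1r.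
have := rmorphM delta (v^-1)%:A v%:A.
rewrite scal_mul mulVr ?lv_unit // scale1r rmorph1 (delta_v hdelta) => vV.
have := congr1 (fun x => x * (- v)%:A) vV.
by rewrite /= -mulrA vv mulr1 mul1r.
Qed.

(** Knowing that scalars go to scalars suffices for [delta] to carry spans to spans. *)
Lemma delta_scal a : exists b, delta a%:A = b%:A.
Proof.
have scal_exp (b : Lambda) n : (b%:A : H) ^+ n = (b ^+ n)%:A.
  by elim: n => [|n IHn]; rewrite ?scale1r // !exprS IHn scal_mul.
have [p [n ->]] := laurentP a; rewrite -peval_lv pevalE -exprVn mulr_suml.
rewrite scaler_suml rmorph_sum /=.
exists (\sum_(i < size p) lconst p`_i * (- v^-1) ^+ i * (- v) ^+ n).
rewrite scaler_suml; apply: eq_bigr => i _.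
rewrite -!scal_mul !rmorphM -!scal_exp !rmorphXn /=.
by rewrite (delta_const hdelta) (delta_v hdelta) delta_lvV.
Qed.

Lemma deltaZ a x : exists b, delta (a *: x) = b *: delta x.
Proof.
have [b bE] := delta_scal a; exists b.
by rewrite -[x]mul1r scalerAl rmorphM bE -scalerAl !mul1r.
Qed.

Lemma delta_hecke_gen i : delta (g i) = - (q^-1 *: g i).
Proof.
have gE : g i = v%:A * (v^-1 *: g i).
  by rewrite -scalerAl mul1r scalerA mulrV ?lv_unit ?scale1r.
rewrite {1}gE rmorphM (delta_gen hdelta) (delta_v hdelta) -scalerAl mul1r scalerA.
by rewrite -scaleNr /lq expr2 invrM ?lv_unit // mulNr.
Qed.

Lemma delta_eigen_q i x : g i * x = - x -> g i * delta x = q *: delta x.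
Proof.
move=> gx; have := congr1 delta gx.
rewrite rmorphM rmorphN delta_hecke_gen mulNr -scalerAl => /oppr_inj gdx.
by rewrite -[in RHS]gdx scalerA mulrV ?lq_unit ?scale1r.
Qed.

Lemma delta_eigen_N1 i x : g i * x = q *: x -> g i * delta x = - delta x.
Proof.
move=> gx; apply: (can_inj (delta_order2 hdelta)).
rewrite rmorphM rmorphN (delta_order2 hdelta) delta_hecke_gen mulNr.
by rewrite -scalerAl gx scalerA mulVr ?lq_unit ?scale1r.
Qed.

Lemma delta_linear_span (A : set H) x :
  linear_span A x -> linear_span [set delta y | y in A] (delta x).
Proof.
case=> r [rA ->]; rewrite rmorph_sum; elim: r rA => [|p r IHr] rA.
  by exists [::]; rewrite !big_nil.
have [p' p'r|r' [r'A r'E]] := IHr; first by apply: rA; rewrite inE p'r orbT.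
have [b bE] := deltaZ p.1 p.2; exists ((b, delta p.2) :: r'); split=> [p'|].
  rewrite inE => /orP[/eqP->|/r'A//] /=.
  by exists p.2 => //; apply: rA; rewrite inE eqxx.
by rewrite !big_cons /= bE r'E.
Qed.

(** For x of eigenvalue q, delta(x) has eigenvalue -1 and lies in the span of A; applying [delta]
    again returns x. Conversely each delta(y) with y in A has eigenvalue q. *)
Lemma delta_eigenspace i (A : set H) :
  left_eigenspace (g i) (- 1) = linear_span A ->
  left_eigenspace (g i) q = linear_span [set delta y | y in A].
Proof.
move=> eigA; have eigP x : linear_span A x <-> g i * x = - x.
  by rewrite -eigA /left_eigenspace /= scaleN1r.
apply/seteqP; split=> x /=.
  move=> /delta_eigen_N1/eigP/delta_linear_span.
  by rewrite (delta_order2 hdelta).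
case=> r [rA ->]; rewrite /left_eigenspace /= mulr_sumr scaler_sumr.
rewrite big_seq [RHS]big_seq; apply: eq_bigr => p /rA[y yA <-].
rewrite -scalerAr delta_eigen_q ?scalerA 1?mulrC //; apply/eigP.
exists [:: (1, y)]; rewrite big_seq1 scale1r; split=> // p'.
by rewrite inE => /eqP->.
Qed.

End Delta.

End KazhdanLusztigBasis.

Theorem proposition3p2 (kappa : fieldType) (I : choiceType)
    (m : coxeter_matrix I)
    (bar : {rmorphism hecke (lq kappa) m -> hecke (lq kappa) m})
    (delta : {rmorphism hecke (lq kappa) m -> hecke (lq kappa) m})
    (C : coxeter_group m -> hecke (lq kappa) m)
    (hbar : is_bar_involution bar)
    (hdelta : is_delta delta)
    (hC : forall w : coxeter_group m, is_KL_element bar w (C w))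
    (j : I) :
  left_eigenspace (hecke_gen (lq kappa) m j) (- 1) =
    linear_span [set C w | w in [set w | bruhat_lt (cox_gen m j * w)%g w]]
  /\
  left_eigenspace (hecke_gen (lq kappa) m j) (lq kappa) =
    linear_span
      [set delta (C w) | w in [set w | bruhat_lt (cox_gen m j * w)%g w]].
Proof.
have eigC := KL_eigenspace hbar hC j; split=> //.
by rewrite (delta_eigenspace hdelta eigC) image_comp.
Qed.
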